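(* For any real $\gamma > -\tfrac12$, the functions $$\Psi^{(\gamma)}_k(\theta)=\begin{cases}\dfrac{1}{\sqrt2}\,\tilde P^{(-1/2,\gamma-1/2)}_0(\cos\theta), & k=0,\\[2mm] \dfrac12\Big[\tilde P^{(-1/2,\gamma-1/2)}_{|k|}(\cos\theta)+i\,\mathrm{sgn}(k)\,\sin(\theta)\,\tilde P^{(1/2,\gamma+1/2)}_{|k|-1}(\cos\theta)\Big], & k\neq0,\end{cases}\qquad k\in\mathbb{Z},$$ are complete and orthonormal in $L^2\big([-\pi,\pi],\mathbb{C};w_\theta^{(\gamma,0)}\big)$, where $w_\theta^{(\gamma,0)}(\theta)=(1+\cos\theta)^\gamma$.
   Context: For $\alpha,\beta>-1$ and $n\in\mathbb{N}_0=\{0,1,2,\dots\}$, $P_n^{(\alpha,\beta)}$ is the classical Jacobi polynomial of degree $n$, orthogonal on $[-1,1]$ with respect to the weight $w_r^{(\alpha,\beta)}(r)=(1-r)^\alpha(1+r)^\beta$, and $\tilde P_n^{(\alpha,\beta)}=P_n^{(\alpha,\beta)}/\sqrt{h_n^{(\alpha,\beta)}}$ with $h_n^{(\alpha,\beta)}=\int_{-1}^1 (P_n^{(\alpha,\beta)})^2 w_r^{(\alpha,\beta)}\,dr$ is its $L^2$-normalization. $L^2(A,\mathbb{C};w)$ is the space of functions $A\to\mathbb{C}$ square integrable with respect to the weight $w$, with inner product $\langle f,g\rangle_w=\int_A f\,\overline{g}\,w$. ''Complete'' means that the finite linear span is dense. *)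

(* Defs.v *)
From HB Require Import structures.
From mathcomp Require Import all_boot all_order all_algebra.
From mathcomp Require Import complex.
From mathcomp Require Import all_classical all_reals all_analysis.

Set Implicit Arguments.
Unset Strict Implicit.
Unset Printing Implicit Defensive.

Import Order.TTheory GRing.Theory Num.Theory.
Import numFieldNormedType.Exports.

Local Open Scope classical_set_scope.
Local Open Scope complex_scope.
Local Open Scope ring_scope.

Section Jacobi.
Context {R : realType}.
Implicit Types (a b x : R) (n : nat).

(* Rising factorial x (x + 1) ... (x + n - 1). *)
Definition pochhammer x n : R := \prod_(i < n) (x + i%:R).

(* Szego, Orthogonal Polynomials, (4.21.2):
     P_n^(a,b)(x) = (a+1)_n / n! * 2F1(-n, n+a+b+1; a+1; (1-x)/2),
   with (a+1)_n / (a+1)_m = (a+m+1)_(n-m) cancelled.  This is the usual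
   standardization P_n^(a,b)(1) = (a+1)_n / n!. *)
Definition jacobi a b n : {poly R} :=
  \sum_(m < n.+1)
    ('C(n, m)%:R * pochhammer (n%:R + a + b + 1) m
       * pochhammer (a + m%:R + 1) (n - m) / n`!%:R)
    *: (2^-1 *: ('X - 1)) ^+ m.

Definition jacobi_weight a b x : R := (1 - x) `^ a * (1 + x) `^ b.

Definition jacobi_h a b n : R :=
  \int[lebesgue_measure]_(x in `[-1, 1])
    ((jacobi a b n).[x] ^+ 2 * jacobi_weight a b x).

Definition jacobi_normalized a b n x : R :=
  (jacobi a b n).[x] / Num.sqrt (jacobi_h a b n).

End Jacobi.

Section WeightedL2.
Context {R : realType}.
Implicit Types (A : set R) (w : R -> R) (f g : R -> R[i]).

Definition complex_integral A f : R[i] :=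
  (\int[lebesgue_measure]_(x in A) complex.Re (f x))
  +i* (\int[lebesgue_measure]_(x in A) complex.Im (f x)).

(* Functions are not quotiented by almost everywhere equality; only their
   values on A matter. *)
Definition L2 A w : set (R -> R[i]) :=
  [set f | [/\ measurable_fun A (fun x => complex.Re (f x) : R),
               measurable_fun A (fun x => complex.Im (f x) : R) &
               lebesgue_measure.-integrable A
                 (fun x => (Normc.normc (f x) ^+ 2 * w x)%:E)]].

Definition L2_inner A w f g : R[i] :=
  complex_integral A (fun x => f x * conjc (g x) * (w x)%:C).

Definition L2_norm A w f : R :=
  Num.sqrt (\int[lebesgue_measure]_(x in A) (Normc.normc (f x) ^+ 2 * w x)).

Definition orthonormal_in_L2 (I : eqType) A w (e : I -> R -> R[i]) : Prop :=
  (forall k, L2 A w (e k)) /\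
  (forall j k, L2_inner A w (e j) (e k) = (j == k)%:R).

Definition finite_span (I : Type) (e : I -> R -> R[i]) : set (R -> R[i]) :=
  [set g | exists (s : seq I) (c : I -> R[i]),
      forall x, g x = \sum_(k <- s) c k * e k x].

Definition complete_in_L2 (I : Type) A w (e : I -> R -> R[i]) : Prop :=
  finite_span e `<=` L2 A w /\
  forall f, L2 A w f -> forall eps : R, 0 < eps ->
    exists2 g, finite_span e g & L2_norm A w (fun x => f x - g x) < eps.

End WeightedL2.

Section Psi.
Context {R : realType}.
Implicit Types (gamma theta : R) (k : int).

Definition theta_weight gamma theta : R := (1 + cos theta) `^ gamma.

Definition Psi gamma k theta : R[i] :=
  if k == 0 then
    ((Num.sqrt 2)^-1
       * jacobi_normalized (- 2^-1) (gamma - 2^-1) 0 (cos theta))%:C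
  else
    (2^-1)%:C *
      ((jacobi_normalized (- 2^-1) (gamma - 2^-1) `|k|%N (cos theta))%:C
       + 'i%C * (sgz k)%:~R * (sin theta)%:C
         * (jacobi_normalized 2^-1 (gamma + 2^-1) (`|k|%N).-1 (cos theta))%:C).

End Psi.

(* Main.v *)
(* With x = cos theta and w = (1 + cos theta)^gamma, all the inner products
   reduce to the functional J p = int_0^pi p(cos theta) w(theta) dtheta on
   polynomials: the even part of Psi_k is a multiple of the Jacobi polynomial of
   degree |k| for e = 0, the odd part is sin theta times the one of degree
   |k| - 1 for e = 1, where the parameters are (e - 1/2, gamma + e - 1/2), and
   J((1 - X^2)^e p q) is the Jacobi inner product.
     Orthogonality: sin theta w(theta) t(cos theta) vanishes at 0 and pi, and the
   integral of its derivative shows that the Jacobi differential operator is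
   symmetric for these inner products.  The Jacobi polynomials are
   eigenvectors, for distinct eigenvalues.
     Completeness: the span of the Psi_k consists of all the functions
   p(cos theta) + sin theta q(cos theta) with complex p and q.  Given h with
   h sqrt(w) in L^2(dtheta), truncate h sqrt(w) and cut it off near the zeros of
   the sine, approximate the result in L^1 by a continuous function, divide by
   sqrt(w), and apply the Weierstrass theorem on [-1, 1] to its even part and to
   its odd part divided by the sine. *)
Require Import Defs.
From mathcomp Require Import all_boot all_order all_algebra.
From mathcomp Require Import complex ring lra.
From mathcomp Require Import all_classical all_reals all_analysis.
From mathcomp Require Import measurable_realfun.

Set Implicit Arguments.
Unset Strict Implicit.
Unset Printing Implicit Defensive.

Import Order.TTheory GRing.Theory Num.Theory.
Import numFieldNormedType.Exports.

Local Open Scope classical_set_scope.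
Local Open Scope ring_scope.

(** * Fundamental theorem of calculus with integrands that may blow up at the end points *)

Section FTC.
Context {R : realType}.
Implicit Types (f F : R -> R) (a b : R).
Notation mu := (@lebesgue_measure R).

Lemma measurable_fun_cc f a b :
  {in `]a, b[, continuous f} -> measurable_fun `[a, b] f.
Proof.
move=> cf; apply: (@measurable_fun_itv_cc _ _ _ false true).
apply: open_continuous_measurable_fun; first exact: interval_open.
exact/in_continuous_mksetP.
Qed.

(** Monotone convergence along compact intervals exhausting []a, b[]: the usual theorem applies on
    each of them, and continuity of [F] at the end points gives the limit. Nonnegativity makes
    integrability of [f] a consequence. *)
Lemma ge0_continuous_FTC2_oo f F a b : a < b ->
  {in `]a, b[, forall x : R, 0 <= f x} ->
  {in `]a, b[, continuous f} ->
  {within `[a, b], continuous F} ->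
  {in `]a, b[, forall x : R, is_derive x 1 F (f x)} ->
  (\int[mu]_(x in `[a, b]) (f x)%:E = (F b - F a)%:E)%E.
Proof.
move=> ab f0 cf cF dF.
have mf : measurable_fun `[a, b] f by exact: measurable_fun_cc.
have [cFi Fa Fb] := (continuous_within_itvP _ ab).1 cF.
(* The factor [(b - a) / 3] keeps [a + e n < b - e n] for every [n], including [n = 0]. *)
pose e n : R := (b - a) / 3 * n.+1%:R^-1.
have e_gt0 n : 0 < e n by rewrite !mulr_gt0 ?subr_gt0.
have e_le n : e n <= (b - a) / 3.
  by rewrite ler_piMr ?divr_ge0 ?subr_ge0 ?(ltW ab)// invf_le1 ?ler1n.
have e_cvg : e n @[n --> \oo] --> 0.
  rewrite -[X in _ --> X](mulr0 ((b - a) / 3)).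
  by apply: cvgM; [exact: cvg_cst|exact: cvg_harmonic].
pose A n := `[a + e n, b - e n]%classic : set R.
have subA n : A n `<=` `]a, b[.
  rewrite /A => x /=; rewrite !in_itv/= => /andP[ax xb].
  by rewrite (lt_le_trans _ ax) ?ltrDl// (le_lt_trans xb)// ltrBlDr ltrDl.
have AE : \bigcup_n A n = `]a, b[%classic.
  apply/seteqP; split => [x [n _]|x]; first exact: subA.
  rewrite /= in_itv/= => /andP[ax xb].
  have : \forall n \near \oo, e n < Num.min (x - a) (b - x).
    have m0 : 0 < Num.min (x - a) (b - x) by rewrite lt_min !subr_gt0 ax.
    by move/cvgrPdist_lt: e_cvg => /(_ _ m0); apply: filterS => n;
       rewrite sub0r normrN gtr0_norm.
  move=> /filter_ex[n]; rewrite lt_min => /andP[h1 h2].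
  exists n => //; rewrite /A /= in_itv/=; apply/andP; split; lra.
have mA n : measurable (A n) by exact: measurable_itv.
have mfA n : measurable_fun (A n) f.
  apply: measurable_funS mf => //; apply: (subset_trans (@subA n)).
  exact: subset_itv_oo_cc.
have intA n : (\int[mu]_(x in A n) (f x)%:E = (F (b - e n) - F (a + e n))%:E)%E.
  have sub x : x \in `[a + e n, b - e n] -> x \in `]a, b[ by exact: subA.
  have lt_n : a + e n < b - e n by have := e_le n; have := ab; lra.
  rewrite /A (@continuous_FTC2 _ f F)//.
  - apply: continuous_in_subspaceT => x /set_mem/sub; exact: cf.
  - have [sl sr] : (a + e n \in `]a, b[) /\ (b - e n \in `]a, b[).
      by split; apply: sub; rewrite in_itv/= ?lexx/= (ltW lt_n).
    split => [x /subset_itv_oo_cc/sub/dF[]//||].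
      exact/cvg_at_right_filter/cFi.
    exact/cvg_at_left_filter/cFi.
  - move=> x /subset_itv_oo_cc/sub/dF dFx; rewrite derive1E; exact: derive_val.
have lim1 : F (b - e n) - F (a + e n) @[n --> \oo] --> F b - F a.
  apply: cvgB.
    apply: (cvg_at_leftP _ _ _).1 Fb _ _; split=> [n|].
      by rewrite ltrBlDr ltrDl.
    by rewrite -[X in _ --> X]subr0; apply: cvgB => //; exact: cvg_cst.
  apply: (cvg_at_rightP _ _ _).1 Fa _ _; split=> [n|]; first by rewrite ltrDl.
  by rewrite -[X in _ --> X]addr0; apply: cvgD => //; exact: cvg_cst.
have lim3 : ((\int[mu]_(x in A n) (f x)%:E) @[n --> \oo] --> (F b - F a)%:E)%E.
  by under eq_fun do rewrite intA; apply: cvg_EFin; [exact: nearW|exact: lim1].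
have mfo : measurable_fun `]a, b[ f.
  by apply: measurable_funS mf => //; exact: subset_itv_oo_cc.
rewrite integral_itv_bndoo; last exact/measurable_EFinP.
rewrite -AE.
have lim2 := @ge0_nondecreasing_set_cvg_integral _ (measurableTypeR R) R A (EFin \o f) mu.
apply: (cvg_unique _ (lim2 _ _ _ _)) => //.
- apply/nondecreasing_seqP => n; rewrite subsetEset /A => x /=.
  have en : e n.+1 <= e n.
    by rewrite /e ler_pM2l ?divr_gt0 ?subr_gt0// lef_pV2 ?posrE// ler_nat.
  rewrite !in_itv/= => /andP[h1 h2]; apply/andP; split; lra.
- by move=> n; apply/measurable_EFinP; exact: mfA.
- by move=> n x /subA xab; rewrite lee_fin f0.
Qed.

Lemma ge0_continuous_FTC2_oo_integrable f F a b : a < b ->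
  {in `]a, b[, forall x : R, 0 <= f x} ->
  {in `]a, b[, continuous f} ->
  {within `[a, b], continuous F} ->
  {in `]a, b[, forall x : R, is_derive x 1 F (f x)} ->
  mu.-integrable `[a, b] (EFin \o f).
Proof.
move=> ab f0 cf cF dF.
have mf : measurable_fun `[a, b] f by exact: measurable_fun_cc.
apply/integrableP; split; first exact/measurable_EFinP.
have mfo : measurable_fun `]a, b[ f.
  by apply: measurable_funS mf => //; exact: subset_itv_oo_cc.
suff -> : (\int[mu]_(x in `[a, b]) `|(f x)%:E| =
           \int[mu]_(x in `[a, b]) (f x)%:E)%E.
  by rewrite (ge0_continuous_FTC2_oo ab f0 cf cF dF) ltry.
rewrite [LHS]integral_itv_bndoo; last exact/measurableT_comp/measurable_EFinP.
rewrite [RHS]integral_itv_bndoo; last exact/measurable_EFinP.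
by apply: eq_integral => x /set_mem xab; rewrite abse_EFin ger0_norm// f0.
Qed.

Lemma is_derive_parameterized_integral f a x u : x < u ->
  mu.-integrable `[a, u] (EFin \o f) -> a < x -> {for x, continuous f} ->
  is_derive x 1 (fun y => parameterized_integral mu a y f) (f x).
Proof.
move=> xu intf ax cf; have [D E] := continuous_FTC1_closed xu intf ax cf.
by split; [exact: D|rewrite -derive1E; exact: E].
Qed.

Lemma continuous_FTC2_oo f F a b : a < b ->
  mu.-integrable `[a, b] (EFin \o f) ->
  {in `]a, b[, continuous f} ->
  {within `[a, b], continuous F} ->
  {in `]a, b[, forall x : R, is_derive x 1 F (f x)} ->
  \int[mu]_(x in `[a, b]) f x = F b - F a.
Proof.
move=> ab intf cf cF dF.
pose G x := parameterized_integral mu a x f - F x.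
have cG : {within `[a, b], continuous G}.
  move=> x; apply: cvgB; last exact: cF.
  exact: (parameterized_integral_continuous (ltW ab) intf).
have dG x : x \in `]a, b[ -> is_derive x 1 G 0.
  move=> xab; have [ax xb] := andP xab.
  have dI := is_derive_parameterized_integral xb intf ax (cf _ xab).
  have dFx := dF _ xab.
  by rewrite -(subrr (f x)); exact: is_deriveB.
have [c _] := MVT ab dG cG.
rewrite mul0r => /eqP; rewrite subr_eq0 /G => /eqP.
rewrite {2}/parameterized_integral set_itv1 Rintegral_set1 /parameterized_integral.
lra.
Qed.

End FTC.

(** * The weight: differentiation, boundary behaviour and integrability *)

Section Weight.
Context {R : realType}.
Implicit Types (p x y : R).

Lemma cosD1_ge0 x : 0 <= 1 + cos x.
Proof. by have := cos_geN1 x; rewrite -subr_ge0 opprK addrC. Qed.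

(** Half-angle formula: [1 + cos x] is twice the square of [cos (x / 2)]. *)
Lemma cosD1_gt0 x : x \in `]-pi, pi[ -> 0 < 1 + cos x.
Proof.
rewrite in_itv/= => /andP[x1 x2]; rewrite -[x](divfK (_ : 2%:R != 0 :> R))//.
rewrite mulr_natr cos_mulr2n subrKC.
have c0 : 0 < cos (x / 2) by apply: cos_gt0_pihalf; apply/andP; split; lra.
by rewrite pmulrn_lgt0 ?exprn_gt0.
Qed.

Lemma theta_weight_ge0 p x : 0 <= theta_weight p x.
Proof. exact: powR_ge0. Qed.

Lemma theta_weight_gt0 p x : 0 < 1 + cos x -> 0 < theta_weight p x.
Proof. exact: powR_gt0. Qed.

Lemma theta_weightN p x : theta_weight p (- x) = theta_weight p x.
Proof. by rewrite /theta_weight cosN. Qed.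

Lemma theta_weightD1 p x : 0 < 1 + cos x ->
  theta_weight (p + 1) x = theta_weight p x * (1 + cos x).
Proof.
by move=> c0; rewrite /theta_weight powRD ?powRr1 ?(ltW c0)// (gt_eqF c0) implybT.
Qed.

Lemma is_derive_theta_weight p x : 0 < 1 + cos x ->
  is_derive x 1 (theta_weight p) (- (p * theta_weight (p - 1) x * sin x)).
Proof.
move=> c0.
have dc : is_derive x 1 (fun y : R => 1 + cos y) (- sin x).
  have := @is_deriveD R R R (cst 1) cos x 1 0 (- sin x).
  by rewrite add0r; apply.
have := @is_derive1_comp R (fun y : R => y `^ p) (fun y : R => 1 + cos y) x _ _ (is_derive1_powR p c0) dc.
by rewrite mulrN.
Qed.

Lemma continuous_theta_weight_gt0 p x : 0 < 1 + cos x ->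
  {for x, continuous (theta_weight p)}.
Proof.
move=> c0; apply: differentiable_continuous; apply/derivable1_diffP.
by case: (is_derive_theta_weight p c0).
Qed.

Lemma continuous_theta_weight p : 0 < p -> continuous (theta_weight p : R -> R).
Proof.
move=> p0 x; have := cosD1_ge0 x; rewrite le_eqVlt => /predU1P[c0|]; last first.
  exact: continuous_theta_weight_gt0.
have w0 : theta_weight p x = 0 by rewrite /theta_weight -c0 powR0 ?gt_eqF.
apply/cvgrPdist_lt => e e0.
have cc : (1 + cos y) @[y --> x] --> 0.
  rewrite [X in _ --> X]c0; apply: cvgD; first exact: cvg_cst.
  exact: continuous_cos.
have := @powR_cvg0 R p p0; move/cvgrPdist_lt => /(_ _ e0).
move=> [d /= d0 hd].
move/cvgrPdist_lt : cc => /(_ _ d0); apply: filterS => y.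
rewrite sub0r normrN w0 => yd; have := cosD1_ge0 y.
(* The limit of the power at 0 is one-sided, so points [y] with [1 + cos y = 0] are treated apart,
   where the power takes the value 0. *)
rewrite le_eqVlt /theta_weight => /predU1P[<-|y0].
  by rewrite powR0 ?gt_eqF// subrr normr0.
by apply: hd => //=; rewrite sub0r normrN.
Qed.

Section sin_weight.
Variables (gamma : R) (hgamma : - 2^-1 < gamma).
Local Notation w := (theta_weight gamma).

(** The boundary factor in the integrations by parts: the sine compensates the possible singularity
    of [w] at [pi] and [- pi]. *)
Definition sin_weight x : R := sin x * w x.

Lemma is_derive_sin_weight x : x \in `]-pi, pi[ ->
  is_derive x 1 sin_weight (w x * ((1 + gamma) * cos x - gamma)).
Proof.
move=> /cosD1_gt0 c0.
have dw := is_derive_theta_weight gamma c0.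
have dsw := @is_deriveM R R sin w x 1 _ _ (is_derive_sin x) dw.
apply: (is_derive_eq dsw); rewrite /GRing.scale/=.
(* Extracting [1 + cos x] from [w] leaves the exponent [gamma - 1] in both terms of the product
   rule. *)
rewrite -[in w x]( subrK 1 gamma) theta_weightD1//.
have -> : sin x * - (gamma * theta_weight (gamma - 1) x * sin x) =
  - gamma * theta_weight (gamma - 1) x * (sin x ^+ 2) by ring.
rewrite sin2cos2; ring.
Qed.

(** Since [|sin x|] is the product of the square roots of [1 - cos x] and [1 + cos x], the exponent
    rises to [gamma + 1/2], which is positive exactly by [hgamma]. This yields continuity where
    [1 + cos x = 0]. *)
Lemma norm_sin_weight x :
  `|sin_weight x| = Num.sqrt (1 - cos x) * theta_weight (gamma + 2^-1) x.
Proof.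
have sE : `|sin x| = Num.sqrt (1 - cos x) * Num.sqrt (1 + cos x).
  rewrite -sqrtr_sqr sin2cos2 -sqrtrM; last by rewrite subr_ge0 cos_le1.
  by congr Num.sqrt; ring.
rewrite normrM (ger0_norm (theta_weight_ge0 _ _)) sE -mulrA; congr (_ * _).
have := cosD1_ge0 x; rewrite le_eqVlt /theta_weight => /predU1P[<-|c0].
  by rewrite sqrtr0 mul0r powR0// gt_eqF// -ltrBlDr sub0r.
rewrite powRD ?(gt_eqF c0) ?implybT// powR12_sqrt ?(ltW c0)//.
by rewrite mulrC.
Qed.

Lemma continuous_sin_weight : continuous sin_weight.
Proof.
move=> x; have := cosD1_ge0 x; rewrite le_eqVlt => /predU1P[c0|c0]; last first.
  by apply: continuousM; [exact: continuous_sin|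
                          exact: continuous_theta_weight_gt0].
have gamma0 : 0 < gamma + 2^-1 by rewrite -ltrBlDr sub0r.
have n0 : `|sin_weight x| = 0.
  by rewrite norm_sin_weight /theta_weight -c0 powR0 ?mulr0// gt_eqF.
have S0 : sin_weight x = 0 by exact/normr0_eq0.
rewrite /continuous_at S0; apply/cvgr0Pnorm_lt => e e0.
have cn : {for x, continuous (fun y => `|sin_weight y|)}.
  have -> : (fun y => `|sin_weight y|) =
      (fun y => Num.sqrt (1 - cos y) * theta_weight (gamma + 2^-1) y).
    by apply/funext => y; exact: norm_sin_weight.
  apply: continuousM; last exact: continuous_theta_weight.
  apply: (@continuous_comp _ _ _ (fun y => 1 - cos y) Num.sqrt).
    by apply: continuousB; [exact: cvg_cst|exact: continuous_cos].
  exact: sqrt_continuous.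
move/cvgrPdist_lt: cn => /(_ _ e0); apply: filterS => y.
by rewrite n0 sub0r normrN normr_id.
Qed.

(* The derivative of [- sin_weight] is at least a positive multiple of [w] minus a
   constant, so [w] is dominated by the derivative of a continuous function. *)
Lemma integrable_theta_weight :
  (@lebesgue_measure R).-integrable `[-pi, pi] (EFin \o w).
Proof.
have hg := hgamma.
(* [K] bounds [(1 + gamma) w (1 + cos)], because [1 + cos x <= 2]. Hence [h], the derivative of
   [K y - sin_weight y], is at least [(1 + 2 gamma) w], twice the bound [d w] that is kept. *)
pose K : R := (1 + gamma) * 2 `^ (gamma + 1).
pose d : R := 2^-1 * (1 + 2 * gamma).
have d0 : 0 < d by rewrite /d; lra.
pose h x := K - w x * ((1 + gamma) * cos x - gamma).
have pp : - pi < pi :> R by rewrite gtrN// pi_gt0.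
have hw x : x \in `]-pi, pi[ -> d * w x <= h x.
  move=> /cosD1_gt0 c0.
  suff : (1 + gamma) * (w x * (1 + cos x)) <= K.
    have : 0 <= d * w x by rewrite mulr_ge0 ?(ltW d0)// theta_weight_ge0.
    by rewrite /h /d => h1 h2; lra.
  rewrite ler_wpM2l//; first by lra.
  rewrite -theta_weightD1// ge0_ler_powR ?nnegrE ?(ltW c0)//; first lra.
  by rewrite lerD2l cos_le1.
have w_cont : {in `]-pi, pi[, continuous w}.
  by move=> x /cosD1_gt0 c0; exact: continuous_theta_weight_gt0.
have h_cont : {in `]-pi, pi[, continuous h}.
  move=> x xpi; apply: cvgB; first exact: cvg_cst.
  apply: cvgM; first exact: w_cont.
  apply: cvgB; last exact: cvg_cst.
  by apply: cvgM; [exact: cvg_cst|exact: continuous_cos].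
have dh x : x \in `]-pi, pi[ ->
    is_derive x 1 (fun y => K * y - sin_weight y) (h x).
  move=> xpi; have ds := is_derive_sin_weight xpi.
  apply: is_derive_eq; rewrite /GRing.scale/= /h; ring.
have ih : (@lebesgue_measure R).-integrable `[-pi, pi] (EFin \o h).
  apply: (@ge0_continuous_FTC2_oo_integrable _ _ (fun y => K * y - sin_weight y)) => //.
  - by move=> x /hw; apply: le_trans; rewrite mulr_ge0 ?(ltW d0)// theta_weight_ge0.
  - apply: continuous_subspaceT => x; apply: continuousB.
      by apply: continuousM; [exact: cvg_cst|exact: cvg_id].
    exact: continuous_sin_weight.
have mw : measurable_fun `[-pi, pi] w by exact: measurable_fun_cc.
have mwo : measurable_fun `]-pi, pi[ w.
  by apply: measurable_funS mw => //; exact: subset_itv_oo_cc.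
suff : (@lebesgue_measure R).-integrable `]-pi, pi[ (EFin \o w).
  move=> /integrableP[_ fin]; apply/integrableP; split; first exact/measurable_EFinP.
  rewrite integral_itv_bndoo//.
  exact/measurableT_comp/measurable_EFinP.
have {}ih : (@lebesgue_measure R).-integrable `]-pi, pi[ (EFin \o h).
  by apply: integrableS ih => //; exact: subset_itv_oo_cc.
apply: le_integrable (integrableZl _ d^-1 ih) => //.
  exact/measurable_EFinP.
move=> x /= xpi; rewrite lee_fin ger0_norm ?theta_weight_ge0//.
by rewrite (le_trans _ (ler_norm _))// ler_pdivlMl// hw.
Qed.

Lemma integrable_continuous_weight (f : R -> R) : continuous f ->
  (@lebesgue_measure R).-integrable `[-pi, pi] (fun x => (f x * w x)%:E).
Proof.
move=> cf; apply: (integrableMr _ _ _ integrable_theta_weight) => //.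
  by apply: measurable_funTS; exact: continuous_measurable_fun.
have /compact_bounded[M [_ mrt]] : compact (f @` `[-pi, pi]).
  by apply: continuous_compact; [exact: continuous_subspaceT|exact: segment_compact].
by exists M; split; rewrite ?num_real // => ? ? ? ?; apply: mrt => //; eexists.
Qed.

End sin_weight.
End Weight.

(** * The functional [jint] and the substitution [x = cos theta] *)

Section JacobiFunctional.
Context {R : realType}.
Variables (gamma : R) (hgamma : - 2^-1 < gamma).
Local Notation w := (theta_weight gamma).
Local Notation mu := (@lebesgue_measure R).
Implicit Types (p q t : {poly R}) (x theta : R) (e n : nat).

Lemma cvg_horner_comp p (f : R -> R) x :
  {for x, continuous f} -> {for x, continuous (fun y => p.[f y])}.
Proof.
by move=> cf; apply: (continuous_comp cf); exact: continuous_horner.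
Qed.

Lemma subset_0pi : `[0, pi] `<=` (`[-pi, pi] : set R).
Proof. by apply: subset_itvr; rewrite bnd_simp oppr_le0 pi_ge0. Qed.

Lemma subset_0pi_oo x : x \in `]0, pi[ -> x \in `]-pi, pi[.
Proof.
by apply: subset_itvr; rewrite bnd_simp oppr_le0 pi_ge0.
Qed.

Lemma continuous_weight_oo : {in `]0, pi[, continuous w}.
Proof.
by move=> x /subset_0pi_oo/cosD1_gt0 c0; exact: continuous_theta_weight_gt0.
Qed.

Lemma integrable_horner_weight p :
  mu.-integrable `[0, pi] (fun x => (p.[cos x] * w x)%:E).
Proof.
have cp : continuous (fun x => p.[cos x]).
  by move=> x; exact/cvg_horner_comp/continuous_cos.
apply: integrableS (integrable_continuous_weight hgamma cp) => //.
exact: subset_0pi.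
Qed.

Definition jint p : R := \int[mu]_(x in `[0, pi]) (p.[cos x] * w x).

Lemma jintD p q : jint (p + q) = jint p + jint q.
Proof.
rewrite /jint -RintegralD//; try exact: integrable_horner_weight.
by apply: eq_Rintegral => x _; rewrite hornerD mulrDl.
Qed.

Lemma jintZ c p : jint (c *: p) = c * jint p.
Proof.
rewrite /jint -RintegralZl//; last exact: integrable_horner_weight.
by apply: eq_Rintegral => x _; rewrite hornerZ mulrA.
Qed.

Lemma jintB p q : jint (p - q) = jint p - jint q.
Proof. by rewrite -scaleN1r jintD jintZ mulN1r. Qed.

(** The integrand is the derivative of [- sin theta w(theta) t(cos theta)], which vanishes at 0 and
    [pi]. *)
Lemma jint_deriv t :
  jint ((gamma%:P - (1 + gamma) *: 'X) * t + (1 - 'X^2) * t^`()) = 0.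
Proof.
set q := (X in jint X).
pose F x := - (sin_weight gamma x * t.[cos x]).
have cw x : {for x, continuous (fun y => t.[cos y])}.
  exact/cvg_horner_comp/continuous_cos.
rewrite /jint (@continuous_FTC2_oo _ _ F) ?pi_gt0//.
- by rewrite /F /sin_weight sinpi sin0 !mul0r oppr0 subrr.
- exact: integrable_horner_weight.
- move=> x xpi; apply: cvgM; last exact: continuous_weight_oo.
  exact/cvg_horner_comp/continuous_cos.
- apply: continuous_subspaceT => x; apply: cvgN; apply: cvgM; last exact: cw.
  exact: continuous_sin_weight.
- move=> x xpi.
  have ds := is_derive_sin_weight gamma (subset_0pi_oo xpi).
  have dt := @is_derive1_comp R (horner t) cos x _ _ (is_derive_poly _ _) (is_derive_cos x).
  have dp := @is_deriveM R R _ _ x 1 _ _ ds dt.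
  have dN := @is_deriveN R R R _ x 1 _ dp.
  have -> : q.[cos x] = (gamma - (1 + gamma) * cos x) * t.[cos x] +
      (1 - cos x ^+ 2) * t^`().[cos x] by rewrite /q !hornerE.
  apply: (is_derive_eq dN); rewrite /GRing.scale/= /sin_weight.
  have -> : sin x * w x * (t^`().[cos x] * - sin x) =
    - (sin x ^+ 2 * w x * t^`().[cos x]) by ring.
  by rewrite sin2cos2; ring.
Qed.

(** All the integrals over [[a, y]] lie between 0 and the total integral 0, and [f] is the
    derivative of this constant function of [y]. *)
Lemma ge0_Rintegral_eq0 (f : R -> R) (a b : R) : a < b ->
  mu.-integrable `[a, b] (EFin \o f) -> (forall x, 0 <= f x) ->
  {in `]a, b[, continuous f} ->
  \int[mu]_(x in `[a, b]) f x = 0 -> {in `]a, b[, forall x, f x = 0}.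
Proof.
move=> ab intf f0 cf If0 x xab; have [ax xb] := andP xab.
have [D E] := continuous_FTC1_closed xb intf ax (cf _ xab).
rewrite -E derive1E.
have U0 y : y \in `]a, b[ -> \int[mu]_(x in `[a, y]) f x = 0.
  rewrite in_itv/= => /andP[ay yb]; apply/eqP; rewrite eq_le Rintegral_ge0// andbT.
  rewrite -If0 -lee_fin /Rintegral !fineK.
  - apply: ge0_subset_integral => //.
    + by case/integrableP : intf.
    + by move=> z _; rewrite lee_fin.
    + by apply: subset_itvl; rewrite bnd_simp ltW.
  - exact: integrable_fin_num.
  - apply: integrable_fin_num => //; apply: integrableS intf => //.
    by apply: subset_itvl; rewrite bnd_simp ltW.
rewrite (@near_eq_derive _ _ _ _ (cst 0)) ?derive_cst ?oner_neq0//.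
near=> y; apply: U0; near: y; exact: near_in_itvoo.
Unshelve. all: by end_near. Qed.

Lemma jint_gt0 p : p != 0 -> (forall x, 0 <= p.[cos x]) -> 0 < jint p.
Proof.
move=> p0 pcos_ge0; rewrite lt_def Rintegral_ge0 ?andbT; last first.
  by move=> x _; rewrite mulr_ge0 ?theta_weight_ge0.
apply: contra_neq p0 => J0.
have z x : x \in `]0, pi[ -> root p (cos x).
  move=> xpi; have := ge0_Rintegral_eq0 (pi_gt0 R)
    (integrable_horner_weight p) _ _ J0 xpi.
  move=> /(_ _ _)/eqP; rewrite mulf_eq0.
  rewrite (gt_eqF (theta_weight_gt0 _ _)) ?orbF; last first.
    exact/cosD1_gt0/subset_0pi_oo.
  apply.
    by move=> y; rewrite mulr_ge0 ?theta_weight_ge0.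
  move=> y ypi; apply: cvgM; last exact: continuous_weight_oo.
  exact/cvg_horner_comp/continuous_cos.
(* The points [pi / (i + 2)] are distinct in []0, pi[], where the cosine is injective; [size p + 1]
   of them give too many roots for a nonzero [p]. *)
pose f (i : nat) : R := pi / i.+2%:R.
have fpi i : f i \in `]0, pi[.
  rewrite in_itv/= divr_gt0 ?pi_gt0//= ltr_pdivrMr// ltr_pMr ?pi_gt0//.
  by rewrite ltr1n.
pose s := [seq cos (f i) | i <- iota 0 (size p).+1].
have us : uniq s.
  rewrite map_inj_in_uniq ?iota_uniq// => i j _ _ /= /cos_inj.
  move=> /(_ (subset_itv_oo_cc (fpi i)) (subset_itv_oo_cc (fpi j))).
  move=> /(mulfI (lt0r_neq0 (pi_gt0 R)))/invr_inj/eqP.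
  by rewrite eqr_nat => /eqP[].
apply/eqP/negPn/negP => p0.
have : all (root p) s by apply/allP => _ /mapP[i _ ->]; exact: z.
move=> /(max_poly_roots p0)/(_ us); rewrite size_map size_iota.
by rewrite ltnNge leqnSn.
Qed.

Lemma within_continuous_compS (A B : set R) (f g : R -> R) :
  {within A, continuous f} -> {within B, continuous g} -> f @` A `<=` B ->
  {within A, continuous (g \o f)}.
Proof.
move=> /subspace_continuousP cf /subspace_continuousP cg AB.
apply/subspace_continuousP => x Ax.
have BfA y : A y -> B (f y) by move=> Ay; apply: AB; exists y.
move=> P /(cg _ (BfA _ Ax)) gP.
have := cf _ Ax _ gP.
apply: (@filterS _ _ (nbhs_filter x)) => y /= h Ay.
by apply: h => //; exact: BfA.
Qed.

Lemma continuous_within_acos : {within `[-1, 1], continuous (@acos R)}.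
Proof.
have lt11 : -1 <= 1 :> R by lra.
have := @segment_can_continuous R 0 pi cos acos (pi_ge0 R) _ (@cosK R).
rewrite cos0 cospi min_r// max_l//; apply.
by apply: continuous_subspaceT => x; exact: continuous_cos.
Qed.

Lemma continuous_powR_comp (f : R -> R) (p x : R) :
  {for x, continuous f} -> 0 < f x -> {for x, continuous (fun y => f y `^ p)}.
Proof.
move=> cf fx0; apply: (@continuous_comp _ _ _ f (fun y : R => y `^ p)) => //.
apply: differentiable_continuous; apply/derivable1_diffP.
by case: (is_derive1_powR p fx0).
Qed.

(** The Jacobi weight is [(1 - x^2)^e (1 + x)^gamma] divided by the square root of [1 - x^2], and
    that quotient is absorbed by the derivative of [acos]. With [U] the running integral on the
    [theta] side, [- U (acos x)] is a primitive of the left integrand; as [q] is nonnegative,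
    [ge0_continuous_FTC2_oo] applies in spite of the end point singularities. *)
Lemma jint_change_of_variable q e : (forall x, 0 <= q.[x]) ->
  \int[mu]_(x in `[-1, 1])
    (q.[x] * jacobi_weight (e%:R - 2^-1) (gamma + e%:R - 2^-1) x) =
  jint (q * (1 - 'X^2) ^+ e).
Proof.
move=> q0; set W := jacobi_weight _ _.
pose u x := (q * (1 - 'X^2) ^+ e).[cos x] * w x.
pose U x := \int[mu]_(t in `[0, x]) u t.
have iu : mu.-integrable `[0, pi] (EFin \o u) by exact: integrable_horner_weight.
have cW : {in `]-1, 1[, continuous W}.
  move=> x; rewrite in_itv/= => /andP[x1 x2]; apply: cvgM.
    apply: (@continuous_powR_comp (fun y => 1 - y)); last by rewrite subr_gt0.
    by apply: cvgB; [exact: cvg_cst|exact: cvg_id].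
  apply: (@continuous_powR_comp (fun y => 1 + y)); last by rewrite -ltrBlDl sub0r.
  by apply: cvgD; [exact: cvg_cst|exact: cvg_id].
have cu : {in `]0, pi[, continuous u}.
  move=> x xpi; apply: cvgM; last exact: continuous_weight_oo.
  exact/cvg_horner_comp/continuous_cos.
have lt11 : -1 < 1 :> R by lra.
rewrite /Rintegral (@ge0_continuous_FTC2_oo _ _ (fun x => - U (acos x))) //=.
- by rewrite acos1 acosN1 opprK /U set_itv1 Rintegral_set1 oppr0 add0r.
- move=> x _; rewrite mulr_ge0// mulr_ge0 ?powR_ge0//.
- move=> x xpi; apply: cvgM; last exact: cW.
  exact: continuous_horner.
- move=> x; apply: cvgN.
  apply: (within_continuous_compS continuous_within_acos
    (parameterized_integral_continuous (pi_ge0 R) iu)).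
  move=> _ [y + <-] /=; rewrite !in_itv/= => y11.
  by rewrite acos_ge0// acos_lepi.
- move=> x x11; have x11' : -1 < x < 1 by move: x11; rewrite in_itv.
  have /andP[x1 x2] := x11'.
  have api : acos x \in `]0, pi[.
    by rewrite in_itv/= acos_gt0 ?acos_ltpi// ?x1 ?x2 ?(ltW x1) ?(ltW x2).
  have [a0 api'] := andP api.
  have dU : is_derive (acos x) 1 U (u (acos x)).
    exact: is_derive_parameterized_integral api' iu a0 (cu _ api).
  have dc := @is_derive1_comp R U acos x _ _ dU (is_derive1_acos x11').
  have dN := @is_deriveN R R R _ x 1 _ dc.
  apply: (is_derive_eq dN).
  rewrite mulrN opprK /u acosK; last by rewrite in_itv/= (ltW x1) (ltW x2).
  rewrite /theta_weight acosK; last by rewrite in_itv/= (ltW x1) (ltW x2).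
  have y1 : 0 < 1 - x by rewrite subr_gt0.
  have y2 : 0 < 1 + x by rewrite -ltrBlDl sub0r.
  have xE : 1 - x ^+ 2 = (1 - x) * (1 + x) by ring.
  have -> : (q * (1 - 'X^2) ^+ e).[x] = q.[x] * (1 - x ^+ 2) ^+ e.
    by rewrite hornerM horner_exp !hornerE.
  rewrite xE.
  rewrite /W /jacobi_weight !powRB ?(gt_eqF y1) ?(gt_eqF y2) ?implybT//.
  rewrite powRD ?(gt_eqF y2) ?implybT// !powR12_sqrt ?(ltW y1) ?(ltW y2)//.
  rewrite !powR_mulrn ?(ltW y1) ?(ltW y2)// sqrtrM ?(ltW y1)//.
  rewrite exprMn invfM; ring.
Qed.

Lemma jacobi_h_jint e n :
  jacobi_h (e%:R - 2^-1) (gamma + e%:R - 2^-1) n =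
  jint (jacobi (e%:R - 2^-1) (gamma + e%:R - 2^-1) n ^+ 2 * (1 - 'X^2) ^+ e).
Proof.
rewrite -jint_change_of_variable => [|x]; last by rewrite horner_exp sqr_ge0.
by apply: eq_Rintegral => x _; rewrite horner_exp.
Qed.

End JacobiFunctional.

(** * Jacobi differential equation and degrees *)

Section JacobiAlgebra.
Context {R : realType}.
Implicit Types (a b x gamma : R) (p q s t : {poly R}) (e k m n : nat).

Lemma pochhammerSr x n : pochhammer x n.+1 = pochhammer x n * (x + n%:R).
Proof. by rewrite /pochhammer big_ord_recr. Qed.

Lemma pochhammerS x n : pochhammer x n.+1 = x * pochhammer (x + 1) n.
Proof.
rewrite /pochhammer big_ord_recl addr0; congr (_ * _).
by apply: eq_bigr => i _; rewrite /= /bump -addrA natrD.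
Qed.

Lemma pochhammer_gt0 x n : 0 < x -> 0 < pochhammer x n.
Proof. by move=> x0; apply: prodr_gt0 => i _; rewrite ltr_wpDr. Qed.

Definition jacobi_coef a b n m : R :=
  'C(n, m)%:R * pochhammer (n%:R + a + b + 1) m
    * pochhammer (a + m%:R + 1) (n - m) / n`!%:R.

(** The ratio of consecutive hypergeometric terms, cleared of denominators. At [m = n] both sides
    vanish. *)
Lemma jacobi_coefS a b n m : (m <= n)%N ->
  m.+1%:R * (m.+1%:R + a) * jacobi_coef a b n m.+1 =
  (n%:R - m%:R) * (n%:R + m%:R + a + b + 1) * jacobi_coef a b n m.
Proof.
rewrite leq_eqVlt => /predU1P[<-|mn].
  by rewrite subrr mul0r mul0r /jacobi_coef bin_small// !mul0r mulr0.
have binE : m.+1%:R * 'C(n, m.+1)%:R = (n%:R - m%:R) * 'C(n, m)%:R :> R.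
  by rewrite -natrM mul_bin_left natrM natrB// ltnW.
rewrite /jacobi_coef pochhammerSr -(subnSK mn) pochhammerS.
have -> : a + m%:R + 1 + 1 = a + m.+1%:R + 1 by rewrite -[m.+1]addn1 natrD; ring.
set A := pochhammer _ _; set B := pochhammer _ _.
transitivity ((m.+1%:R * 'C(n, m.+1)%:R) * (m.+1%:R + a) *
  (A * (n%:R + a + b + 1 + m%:R)) * B / n`!%:R); first by ring.
by rewrite binE -[m.+1]addn1 natrD; ring.
Qed.

Definition jacobi_op a b p : {poly R} :=
  (1 - 'X^2) * p^`()^`() + ((b - a)%:P - (a + b + 2) *: 'X) * p^`().

Lemma jacobi_op_sum a b n (c : nat -> R) (f : nat -> {poly R}) :
  jacobi_op a b (\sum_(i < n) c i *: f i) =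
  \sum_(i < n) c i *: jacobi_op a b (f i).
Proof.
have dS (g : nat -> {poly R}) : (\sum_(i < n) g i)^`() = \sum_(i < n) (g i)^`().
  exact: raddf_sum.
rewrite /jacobi_op (dS (fun i => c i *: f i)) (dS (fun i => (c i *: f i)^`())).
rewrite !mulr_sumr -big_split/=.
by apply: eq_bigr => i _; rewrite !derivZ -!scalerAr scalerDr.
Qed.

Local Notation Y := (2^-1 *: ('X - 1) : {poly R}).

Lemma deriv_Y : Y^`() = (2^-1)%:P.
Proof. by rewrite derivZ derivB derivX derivC subr0 alg_polyC. Qed.

(** With [X = 2 Y + 1] one has [1 - X^2 = - 4 Y (Y + 1)], so the operator sends a power of [Y] to a
    combination of two consecutive powers. The differential equation thereby becomes the two-term
    recurrence [jacobi_coefS]. *)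
Lemma jacobi_op_Yexp a b m :
  jacobi_op a b (Y ^+ m.+1) =
  - (m.+1%:R * (m.+1%:R + a)) *: Y ^+ m
  + - (m.+1%:R * (m.+1%:R + a + b + 1)) *: Y ^+ m.+1.
Proof.
rewrite -(mul_polyC (- (_ * (_ + a)))) -(mul_polyC (- (_ * (_ + b + 1)))).
have h2 : 2 * (2^-1)%:P = 1 :> {poly R}.
  by rewrite -polyC_natr -polyCM mulfV ?pnatr_eq0.
have XE : 'X = 2 * Y + 1 :> {poly R}.
  by rewrite -mul_polyC mulrA h2 mul1r subrK.
have dY := deriv_Y; rewrite /jacobi_op -(mul_polyC (a + b + 2)).
have dh : (2^-1 : R)%:P^`() = 0 by exact: derivC.
(* From here on only [2 h = 1], [h' = 0] and [y' = h] are used; products [2 * h] are isolated so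
   that [h2] can replace them between calls to [ring]. *)
move: Y dY XE => y dy ->; move: (2^-1)%:P h2 dh dy => h h2 dh dy.
rewrite deriv_exp dy /= !(polyCD, polyCN, polyCM, polyC_natr, polyCB) polyC1.
case: m => [|m].
  rewrite expr0 expr1 mulr1 mulr1n dh mulr0 add0r.
  transitivity ((b%:P - a%:P) * h - (a%:P + b%:P + 2) * (2 * h * y + h)).
    by ring.
  rewrite h2; transitivity (- (1 + a%:P) * (2 * h) - (a%:P + b%:P + 2) * y); last first.
    by rewrite h2; ring.
  by ring.
rewrite derivMn derivM dh mul0r add0r deriv_exp dy /=.
have yS : y ^+ m.+1 = y * y ^+ m by rewrite exprS.
have ySS : y ^+ m.+2 = y * (y * y ^+ m) by rewrite !exprS.
rewrite ySS yS; move: (y ^+ m) => z.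
transitivity (- (2 * h) * (2 * h) * y * (1 + y) * z * m.+1%:R * m.+2%:R
  + ((b%:P - a%:P) * h - (a%:P + b%:P + 2) * (2 * h * y + h)) * y * z * m.+2%:R).
  by ring.
rewrite h2.
transitivity (- y * (1 + y) * z * m.+1%:R * m.+2%:R
  + (- (1 + a%:P) * (2 * h) - (a%:P + b%:P + 2) * y) * y * z * m.+2%:R).
  by ring.
by rewrite h2 -[m.+2]addn1 -[m.+1]addn1 !natrD; ring.
Qed.

Lemma jacobiE a b n :
  jacobi a b n = \sum_(m < n.+1) jacobi_coef a b n m *: Y ^+ m.
Proof. by []. Qed.

Lemma jacobi_ode a b n :
  jacobi_op a b (jacobi a b n) =
  - (n%:R * (n%:R + a + b + 1)) *: jacobi a b n.
Proof.
rewrite jacobiE (@jacobi_op_sum _ _ _ _ (fun m => Y ^+ m)) big_ord_recl.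
have -> : jacobi_op a b (Y ^+ 0) = 0.
  by rewrite expr0 /jacobi_op !derivC !mulr0 addr0.
rewrite scaler0 add0r.
(* Both sums are extended to the range [0..n]: the added term has the factor [n - m] at [m = n] in
   the first, and the factor [m] at [m = 0] in the second. The coefficients then add up by [(n -
   m)(n + m + s) + m (m + s) = n (n + s)], where [s = a + b + 1]. *)
pose c m := jacobi_coef a b n m.
have E1 : \sum_(m < n) (- (n%:R - m%:R) * (n%:R + m%:R + a + b + 1) * c m) *: Y ^+ m =
    \sum_(m < n.+1) (- (n%:R - m%:R) * (n%:R + m%:R + a + b + 1) * c m) *: Y ^+ m.
  by rewrite big_ord_recr/= subrr oppr0 !mul0r scale0r addr0.
have E2 : \sum_(m < n) (- (m.+1%:R * (m.+1%:R + a + b + 1)) * c m.+1) *: Y ^+ m.+1 =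
    \sum_(m < n.+1) (- (m%:R * (m%:R + a + b + 1)) * c m) *: Y ^+ m.
  by rewrite big_ord_recl/= mul0r oppr0 mul0r scale0r add0r.
transitivity (
  \sum_(m < n) (- (n%:R - m%:R) * (n%:R + m%:R + a + b + 1) * c m) *: Y ^+ m +
  \sum_(m < n) (- (m.+1%:R * (m.+1%:R + a + b + 1)) * c m.+1) *: Y ^+ m.+1).
  rewrite -big_split/=; apply: eq_bigr => m _.
  rewrite /bump/= jacobi_op_Yexp scalerDr !scalerA; congr (_ *: _ + _ *: _).
    by rewrite mulrC !mulNr jacobi_coefS// ltnW.
  by rewrite mulrC.
rewrite E1 E2 -big_split/= scaler_sumr; apply: eq_bigr => m _.
by rewrite -scalerDl scalerA; congr (_ *: _); rewrite /c; ring.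
Qed.

(** In powers of [Y] the leading coefficient is [(n+a+b+1)_n / n!]. The case [n = 0] is separate
    because [a + b + 1] equals [gamma] when [e = 0], and [gamma] may be negative. *)
Lemma size_jacobi a b n : 0 < n%:R + a + b + 1 \/ n = 0%N ->
  size (jacobi a b n) = n.+1.
Proof.
move=> h; pose q := \poly_(m < n.+1) jacobi_coef a b n m.
have cn : jacobi_coef a b n n != 0.
  rewrite /jacobi_coef binn subnn {2}/pochhammer big_ord0 mulr1 mul1r.
  rewrite mulf_neq0 ?invr_eq0 ?pnatr_eq0 -?lt0n ?fact_gt0//.
  case: h => [h|->]; last by rewrite /pochhammer big_ord0 oner_neq0.
  by rewrite gt_eqF// pochhammer_gt0.
have -> : jacobi a b n = q \Po Y.
  rewrite jacobiE comp_polyE size_poly_eq//.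
  by apply: eq_bigr => m _; rewrite coef_poly ltn_ord.
have sY : size Y = 2.
  by rewrite size_scale ?invr_eq0 ?pnatr_eq0// size_XsubC.
by rewrite size_comp_poly2 ?size_poly_eq.
Qed.

(** Triangular elimination, from the top degree downwards. *)
Lemma poly_basis_span (P : nat -> {poly R}) n p :
  (forall m, size (P m) = m.+1) -> (size p <= n)%N ->
  exists c : nat -> R, p = \sum_(i < n) c i *: P i.
Proof.
move=> sP; elim: n p => [p|n IH p sp].
  by rewrite leqn0 size_poly_eq0 => /eqP ->; exists (fun=> 0); rewrite big_ord0.
have lP : lead_coef (P n) != 0 by rewrite lead_coef_eq0 -size_poly_eq0 sP.
pose k := p`_n / lead_coef (P n).
have [|c pE] := IH (p - k *: P n).
  apply/leq_sizeP => j; rewrite leq_eqVlt => /predU1P[<-|nj].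
    rewrite coefB coefZ /k lead_coefE sP/= divfK ?subrr//.
    by move: lP; rewrite lead_coefE sP.
  rewrite coefB coefZ [p`_j]nth_default ?(leq_trans sp)//.
  by rewrite [(P n)`_j]nth_default ?sP// mulr0 subrr.
exists (fun i => if i == n then k else c i).
rewrite big_ord_recr/= eqxx -[LHS](subrK (k *: P n)) pE; congr (_ + _).
by apply: eq_bigr => i _; rewrite ltn_eqF.
Qed.

End JacobiAlgebra.

(** * Orthogonality through the symmetric differential operator *)

Section JacobiOrthogonality.
Context {R : realType}.
Variables (gamma : R) (hgamma : - 2^-1 < gamma).
Implicit Types (p q s : {poly R}) (e k m n : nat).

Local Notation weight e := ((1 - 'X^2) ^+ e : {poly R}).
Local Notation jac e := (jacobi (e%:R - 2^-1) (gamma + e%:R - 2^-1) : nat -> {poly R}).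
Local Notation op e := (@jacobi_op R (e%:R - 2^-1) (gamma + e%:R - 2^-1)).
Local Notation J := (jint gamma).

(** This is [jint_deriv] for [(1 - X^2)^e s]: differentiating the power contributes [- 2 e X],
    whence the shifted coefficient. *)
Lemma jint_weight_deriv e s :
  J (weight e * ((gamma%:P - (1 + gamma + 2 * e%:R) *: 'X) * s + (1 - 'X^2) * s^`())) = 0.
Proof.
rewrite -(jint_deriv hgamma (weight e * s)); congr J.
have dv : (1 - 'X^2) * (weight e)^`() = - (2 * e%:R) * 'X * weight e.
  case: e => [|e]; first by rewrite expr0 derivC mulr0 mulr0 oppr0 !mul0r.
  rewrite deriv_exp derivB derivC derivXn sub0r /= expr1 [X in _ = _ * X]exprS.
  by ring.
rewrite derivM [X in _ = _ + X]mulrDr.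
have -> : (1 - 'X^2) * ((weight e)^`() * s) = - (2 * e%:R) * 'X * weight e * s.
  by rewrite mulrA dv.
rewrite -!mul_polyC.
rewrite !(polyCD, polyCN, polyCM, polyC_natr) polyC1; ring.
Qed.

(** Lagrange identity: the difference of the two integrands is the exact derivative of
    [jint_weight_deriv] for the Wronskian [s = p' q - p q']. *)
Lemma jacobi_op_selfadjoint e p q :
  J (weight e * (op e p * q)) = J (weight e * (p * op e q)).
Proof.
apply/eqP; rewrite -subr_eq0 -jintB//; apply/eqP.
rewrite -[RHS](jint_weight_deriv e (p^`() * q - p * q^`())); congr J.
rewrite -mulrBr; congr (_ * _).
rewrite derivB !derivM /jacobi_op.
have -> : gamma + e%:R - 2^-1 - (e%:R - 2^-1) = gamma by ring.
have -> : e%:R - 2^-1 + (gamma + e%:R - 2^-1) + 2 = 1 + gamma + 2 * e%:R by field.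
ring.
Qed.

Lemma jacobi_orthogonal e m n : m != n -> J (weight e * (jac e m * jac e n)) = 0.
Proof.
move=> mn; have := jacobi_op_selfadjoint e (jac e m) (jac e n).
rewrite !jacobi_ode -!scalerAl -!scalerAr !jintZ// => /eqP.
rewrite -subr_eq0 -mulrBl mulf_eq0 => /orP[|/eqP//].
have -> : - (m%:R * (m%:R + (e%:R - 2^-1) + (gamma + e%:R - 2^-1) + 1)) -
  - (n%:R * (n%:R + (e%:R - 2^-1) + (gamma + e%:R - 2^-1) + 1)) =
  (n%:R - m%:R) * (m%:R + n%:R + gamma + 2 * e%:R) by field.
rewrite mulf_eq0 subr_eq0 eqr_nat eq_sym (negbTE mn)/= gt_eqF//.
(* Distinct degrees are not both 0, so [m + n + gamma + 2 e > 1/2] and the eigenvalues differ. *)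
have : (1 : R) <= m%:R + n%:R.
  rewrite -natrD ler1n; case: m n mn => [|m] [|n]//.
have : 0 <= e%:R :> R by [].
have := hgamma; lra.
Qed.

Lemma size_jac e n : size (jac e n) = n.+1.
Proof.
apply: size_jacobi; case: n => [|n]; [by right|left].
have : 0 <= n%:R :> R by []. have : 0 <= e%:R :> R by [].
by rewrite -[n.+1]addn1 natrD; have := hgamma; lra.
Qed.

End JacobiOrthogonality.

(** * Folding integrals over a symmetric interval *)

Section Symmetry.
Context {R : realType}.
Variables (gamma : R) (hgamma : - 2^-1 < gamma).
Local Notation w := (theta_weight gamma).
Local Notation mu := (@lebesgue_measure R).
Implicit Types (f g : R -> R) (x : R).

(** With [U] the running integral from [- a], the function [U x - U (- x)] is a primitive of the
    folded integrand; it is 0 at 0 and the full integral at [a]. *)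
Lemma Rintegral_fold f (a : R) : 0 < a ->
  mu.-integrable `[-a, a] (EFin \o f) ->
  mu.-integrable `[0, a] (fun x => (f x + f (- x))%:E) ->
  {in `]-a, a[, continuous f} ->
  \int[mu]_(x in `[-a, a]) f x = \int[mu]_(x in `[0, a]) (f x + f (- x)).
Proof.
move=> a0 intf intfN cf; have Naa : - a < a by lra.
pose U x := parameterized_integral mu (- a) x f.
have cU : {within `[-a, a], continuous U}.
  exact: parameterized_integral_continuous (ltW Naa) intf.
have sub0 : `[0, a] `<=` (`[-a, a] : set R).
  by apply: subset_itvr; rewrite bnd_simp; lra.
have dU x : x \in `]-a, a[ -> is_derive x 1 U (f x).
  move=> xa; have [ax xa'] := andP xa.
  exact: is_derive_parameterized_integral xa' intf ax (cf _ xa).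
have inN x : x \in `]0, a[ -> (x \in `]-a, a[) /\ (- x \in `]-a, a[).
  by rewrite !in_itv/= => /andP[? ?]; split; apply/andP; split; lra.
rewrite [RHS](@continuous_FTC2_oo _ _ (fun x => U x - U (- x))) //.
- by rewrite oppr0 subrr subr0 /U {2}/parameterized_integral set_itv1
    Rintegral_set1 subr0.
- move=> x /inN[x1 x2]; apply: cvgD; first exact: cf.
  apply: (@continuous_comp _ _ _ (fun y : R => - y) f).
    by apply: cvgN; exact: cvg_id.
  exact: cf.
- move=> x; apply: cvgB; first exact: (continuous_subspaceW sub0 cU).
  apply: (@within_continuous_compS _ _ `[-a, a] (fun y : R => - y) U) => //.
    by apply: continuous_subspaceT => y; apply: cvgN; exact: cvg_id.
  move=> _ [y ya <-]; have : y \in `[0, a] by [].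
  by rewrite /= !in_itv/= => /andP[? ?]; apply/andP; split; lra.
- move=> x /inN[/dU d1 /dU d2].
  have dN : is_derive x 1 (fun y : R => - y) (-1).
    by have := @is_deriveN R R R id x 1 1; apply.
  have dc := @is_derive1_comp R U (fun y : R => - y) x _ _ d2 dN.
  have := @is_deriveB R R R _ _ x 1 _ _ d1 dc.
  by rewrite mulrN1 opprK.
Qed.

Lemma continuous_opp f : continuous f -> continuous (fun x => f (- x)).
Proof.
move=> cf x; apply: (@continuous_comp _ _ _ (fun y : R => - y) f); last exact: cf.
by apply: cvgN; exact: cvg_id.
Qed.

Lemma continuous_weight_NpiPpi : {in `]-pi, pi[, continuous w}.
Proof. by move=> x /cosD1_gt0 c0; exact: continuous_theta_weight_gt0. Qed.

Lemma Rintegral_weight_fold f : continuous f ->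
  \int[mu]_(x in `[-pi, pi]) (f x * w x) =
  \int[mu]_(x in `[0, pi]) ((f x + f (- x)) * w x).
Proof.
move=> cf; have cf' := continuous_opp cf.
rewrite (@Rintegral_fold (fun x => f x * w x)) ?pi_gt0//.
- by apply: eq_Rintegral => x _; rewrite theta_weightN mulrDl.
- exact: (integrable_continuous_weight hgamma cf).
- have -> : (fun x => (f x * w x + f (- x) * w (- x))%:E) =
      (fun x => ((f x + f (- x)) * w x)%:E).
    by apply/funext => x; rewrite theta_weightN mulrDl.
  apply: integrableS (integrable_continuous_weight hgamma (fun x => cvgD (cf x) (cf' x))) => //.
  exact: subset_0pi.
- by move=> x xpi; apply: cvgM; [exact: cf|exact: continuous_weight_NpiPpi].
Qed.

End Symmetry.

(** * Orthonormality of the functions [Psi] *)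

Section Orthonormality.
Context {R : realType}.
Variables (gamma : R) (hgamma : - 2^-1 < gamma).
Local Notation w := (theta_weight gamma).
Local Notation mu := (@lebesgue_measure R).
Local Notation J := (jint gamma).
Local Notation I := (`[-pi, pi]%classic : set R).
Implicit Types (f g : R -> R) (x : R) (p q : {poly R}) (e n : nat) (k : int).

Lemma sqr_normc (a b : R) : Normc.normc (a +i* b)%C ^+ 2 = a ^+ 2 + b ^+ 2.
Proof. by rewrite /= sqr_sqrtr// addr_ge0 ?sqr_ge0. Qed.

Lemma L2_continuous f g : continuous f -> continuous g ->
  L2 I w (fun x => (f x +i* g x)%C).
Proof.
move=> cf cg; split => /=.
- by apply: measurable_funTS; exact: continuous_measurable_fun.
- by apply: measurable_funTS; exact: continuous_measurable_fun.
- have -> : (fun x => (Normc.normc (f x +i* g x)%C ^+ 2 * w x)%:E) =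
      (fun x => ((f x ^+ 2 + g x ^+ 2) * w x)%:E).
    by apply/funext => x; rewrite sqr_normc.
  apply: (integrable_continuous_weight hgamma) => x.
  by apply: cvgD; rewrite /=; [apply: cvgM; exact: cf|apply: cvgM; exact: cg].
Qed.

Lemma L2_innerE (a b c d : R -> R) :
  L2_inner I w (fun x => (a x +i* b x)%C) (fun x => (c x +i* d x)%C) =
  ((\int[mu]_(x in I) ((a x * c x + b x * d x) * w x)) +i*
   (\int[mu]_(x in I) ((b x * c x - a x * d x) * w x)))%C.
Proof.
rewrite /L2_inner /complex_integral; congr (_ +i* _)%C;
  apply: eq_Rintegral => x _ /=; ring.
Qed.

(** These are exactly the real trigonometric polynomials, split into even and odd part. *)
Definition trig_poly (p q : {poly R}) x : R := p.[cos x] + sin x * q.[cos x].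

(** One family for both parameter pairs of [Psi]: [e = 0] for the cosine part, [e = 1] for the sine
    part. *)
Definition normalized_jacobi e n : {poly R} :=
  (Num.sqrt (jacobi_h (e%:R - 2^-1) (gamma + e%:R - 2^-1) n))^-1 *:
  jacobi (e%:R - 2^-1) (gamma + e%:R - 2^-1) n.

Lemma one_sub_cos2_ge0 e x : 0 <= ((1 - 'X^2) ^+ e : {poly R}).[cos x].
Proof.
by rewrite horner_exp !hornerE -sin2cos2 exprn_ge0// sqr_ge0.
Qed.

Lemma jacobi_h_gt0 e n : 0 < jacobi_h (e%:R - 2^-1) (gamma + e%:R - 2^-1) n.
Proof.
rewrite jacobi_h_jint//; apply: jint_gt0 => //.
  rewrite mulf_neq0 ?expf_neq0 -?size_poly_eq0 ?size_jac//.
  by rewrite -opprB size_polyN size_XnsubC.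
by move=> x; rewrite hornerM horner_exp mulr_ge0 ?sqr_ge0 ?one_sub_cos2_ge0.
Qed.

Lemma size_normalized_jacobi e n : size (normalized_jacobi e n) = n.+1.
Proof.
by rewrite size_scale ?size_jac// invr_eq0 sqrtr_eq0 -ltNge jacobi_h_gt0.
Qed.

Lemma normalized_jacobi_orthonormal e m n :
  J ((1 - 'X^2) ^+ e * (normalized_jacobi e m * normalized_jacobi e n)) =
  (m == n)%:R.
Proof.
rewrite /normalized_jacobi -scalerAl -!scalerAr !jintZ//.
have [<-|mn] := eqVneq m n; last by rewrite jacobi_orthogonal// !mulr0.
rewrite [_ ^+ e * _]mulrC -expr2 -jacobi_h_jint//.
have h0 := jacobi_h_gt0 e m; have := sqr_sqrtr (ltW h0).
have : Num.sqrt (jacobi_h (e%:R - 2^-1) (gamma + e%:R - 2^-1) m) != 0.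
  by rewrite sqrtr_eq0 -ltNge.
by move: (Num.sqrt _) => r r0 <-; rewrite -[RHS]/(1 : R); field.
Qed.

Definition Psi_even k : {poly R} :=
  (if k == 0 then (Num.sqrt 2)^-1 else 2^-1) *: normalized_jacobi 0 `|k|.

(** At [k = 0] the truncated index is harmless: [sgz 0 = 0] makes the polynomial zero. *)
Definition Psi_odd k : {poly R} :=
  (2^-1 * (sgz k)%:~R) *: normalized_jacobi 1 (`|k|%N).-1.

Lemma PsiE k x :
  Psi gamma k x = ((Psi_even k).[cos x] +i* (sin x * (Psi_odd k).[cos x]))%C.
Proof.
have E0 n y : jacobi_normalized (- 2^-1) (gamma - 2^-1) n y = (normalized_jacobi 0 n).[y].
  rewrite /normalized_jacobi hornerZ mulrC /jacobi_normalized.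
  have -> : 0%:R - 2^-1 = - 2^-1 :> R by ring.
  by have -> : gamma + 0%:R - 2^-1 = gamma - 2^-1 by ring.
have E1 n y : jacobi_normalized 2^-1 (gamma + 2^-1) n y = (normalized_jacobi 1 n).[y].
  rewrite /normalized_jacobi hornerZ mulrC /jacobi_normalized.
  have -> : 1%:R - 2^-1 = 2^-1 :> R by field.
  by have -> : gamma + 1%:R - 2^-1 = gamma + 2^-1 by field.
rewrite /Psi /Psi_even /Psi_odd !E0 !E1; case: eqP => [->|_].
  by rewrite sgz0 mulr0z mulr0 scale0r horner0 mulr0 [in RHS]hornerZ.
move: (normalized_jacobi 0 _) (normalized_jacobi 1 _) => P Q.
rewrite !hornerZ -(rmorph_int (real_complex R)).
move: P.[_] Q.[_] (sgz k)%:~R (sin x) => a b s t.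
by apply/eqP; rewrite eq_complex /=; apply/andP; split; apply/eqP; ring.
Qed.

Lemma Rintegral_trig_even p :
  \int[mu]_(x in I) (p.[cos x] * w x) = 2 * J p.
Proof.
rewrite (Rintegral_weight_fold hgamma) => [|x]; last first.
  exact/cvg_horner_comp/continuous_cos.
rewrite -jintZ//; apply: eq_Rintegral => x _; rewrite cosN hornerZ; ring.
Qed.

Lemma Rintegral_trig_odd p :
  \int[mu]_(x in I) (sin x * p.[cos x] * w x) = 0.
Proof.
rewrite (Rintegral_weight_fold hgamma (f := fun x => sin x * p.[cos x])); last first.
  move=> x; apply: cvgM; first exact: continuous_sin.
  exact/cvg_horner_comp/continuous_cos.
under eq_Rintegral do rewrite sinN cosN mulNr subrr mul0r.
by rewrite Rintegral_cst// mul0r.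
Qed.

(** The integral over [[-pi, pi]] is twice [J]. The norm is thus [2 * 1/2] at 0, and [2 (1/4 + 1/4)]
    elsewhere, with the second quarter coming from [Psi_odd_inner]. *)
Lemma Psi_even_inner j k :
  J (Psi_even j * Psi_even k) =
  (`|j|%N == `|k|%N)%:R * (if j == 0 then 2^-1 else 4^-1).
Proof.
have := normalized_jacobi_orthonormal 0 `|j| `|k|.
rewrite expr0 mul1r => JE; rewrite /Psi_even -scalerAl -scalerAr !jintZ// JE.
have [jk|_] := eqVneq `|j|%N `|k|%N; last by rewrite /= mulr0n !mulr0 mul0r.
have -> : (k == 0) = (j == 0) by rewrite -!absz_eq0 jk.
case: ifP => _; rewrite /= mulr1n mulr1 mul1r.
  by rewrite -invfM -expr2 sqr_sqrtr.
by rewrite -invfM -natrM.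
Qed.

Lemma Psi_odd_inner j k :
  J ((1 - 'X^2) * (Psi_odd j * Psi_odd k)) =
  (`|j|%N == `|k|%N)%:R * (sgz j * sgz k)%:~R * 4^-1.
Proof.
have := normalized_jacobi_orthonormal 1 (`|j|%N).-1 (`|k|%N).-1.
rewrite expr1 /Psi_odd.
move: (normalized_jacobi 1 _) (normalized_jacobi 1 _) => P Q JE.
rewrite -scalerAl -!scalerAr !jintZ// JE.
have [->|j0] := eqVneq j 0; first by rewrite sgz0 !(mul0r, mulr0z, mulr0).
have [->|k0] := eqVneq k 0; first by rewrite sgz0 !(mulr0, mulr0z, mul0r).
have -> : ((`|j|%N).-1 == (`|k|%N).-1) = (`|j|%N == `|k|%N).
  rewrite -eqSS !prednK ?absz_gt0//.
by rewrite intrM; field.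
Qed.

Lemma Psi_orthonormal : orthonormal_in_L2 I w (Psi gamma).
Proof.
have PE k : Psi gamma k = fun x =>
    ((Psi_even k).[cos x] +i* (sin x * (Psi_odd k).[cos x]))%C.
  by apply/funext => x; exact: PsiE.
have cc p : continuous (fun x => p.[cos x]).
  by move=> x; exact/cvg_horner_comp/continuous_cos.
split=> [k|j k]; rewrite !PE.
  apply: L2_continuous => // x; apply: cvgM; last exact: cc.
  exact: continuous_sin.
rewrite L2_innerE.
(* The imaginary part integrates an odd function. *)
have -> : \int[mu]_(x in I) ((sin x * (Psi_odd j).[cos x] * (Psi_even k).[cos x] -
    (Psi_even j).[cos x] * (sin x * (Psi_odd k).[cos x])) * w x) = 0.
  rewrite -(Rintegral_trig_odd (Psi_odd j * Psi_even k - Psi_even j * Psi_odd k)).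
  apply: eq_Rintegral => x _; rewrite hornerD hornerN !hornerM; ring.
have -> : \int[mu]_(x in I) (((Psi_even j).[cos x] * (Psi_even k).[cos x] +
    sin x * (Psi_odd j).[cos x] * (sin x * (Psi_odd k).[cos x])) * w x) = (j == k)%:R.
  transitivity (\int[mu]_(x in I)
      ((Psi_even j * Psi_even k + (1 - 'X^2) * (Psi_odd j * Psi_odd k)).[cos x] * w x)).
    apply: eq_Rintegral => x _; rewrite hornerD !hornerM.
    have -> : (1 - 'X^2 : {poly R}).[cos x] = sin x ^+ 2 by rewrite !hornerE sin2cos2.
    by ring.
  rewrite Rintegral_trig_even jintD// Psi_even_inner Psi_odd_inner.
  have [jk|jk] := eqVneq `|j|%N `|k|%N; last first.
    rewrite (_ : (j == k) = false) /= ?mulr0n ?mul0r ?addr0 ?mulr0//.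
    by apply: contraNF jk => /eqP ->.
  (* For [j = - k] with [k] nonzero, the even and odd contributions [1/4] and [- 1/4] cancel. *)
  have /orP[/eqP jk'|/eqP jk'] : (j == k) || (j == - k).
    by rewrite -eqr_norm2 -!abszE jk.
    rewrite jk' eqxx /= mulr1n; have [->|k0] := eqVneq k 0.
      by rewrite sgz0 mulr0; field.
    case: (sgzP k) k0 => // _ _; by field.
  rewrite jk' oppr_eq0 /= mulr1n; have [->|k0] := eqVneq k 0.
    by rewrite sgz0 mulr0 oppr0 !eqxx /=; field.
  rewrite (_ : (- k == k) = false); last first.
    by apply: contraNF k0; rewrite eqNr.
  have -> : sgz (- k) * sgz k = -1.
    rewrite sgzN; case: sgzP k0 => // _ _.
  by rewrite mulrNz /=; field.
by case: (j == k).
Qed.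

End Orthonormality.

(** * Weierstrass approximation by Bernstein polynomials *)

Section Weierstrass.
Context {R : realType}.
Implicit Types (G : R -> R) (phi psi : nat -> R) (x y z : R) (n k : nat).

(* The Bernstein polynomial of degree [n] with values [phi 0, ..., phi n], on
   [-1, 1], built from Pascal's rule: its value at [x] is the mean of [phi k] for
   [k] binomial with parameters [n] and [(1 + x) / 2]. *)
Fixpoint bernstein n phi : {poly R} :=
  if n is n'.+1 then
    2^-1 *: ((1 - 'X) * bernstein n' phi + (1 + 'X) * bernstein n' (phi \o succn))
  else (phi 0%N)%:P.

Lemma bernsteinS n phi x :
  (bernstein n.+1 phi).[x] = (1 - (1 + x) / 2) * (bernstein n phi).[x] +
    (1 + x) / 2 * (bernstein n (phi \o succn)).[x].
Proof. by rewrite /= !(hornerZ, hornerD, hornerM, hornerN, hornerX, hornerC); field. Qed.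

Lemma bernstein0 phi x : (bernstein 0 phi).[x] = phi 0%N.
Proof. by rewrite /= hornerC. Qed.

Lemma le_bernstein n phi psi x : -1 <= x <= 1 ->
  (forall k, (k <= n)%N -> phi k <= psi k) ->
  (bernstein n phi).[x] <= (bernstein n psi).[x].
Proof.
move=> /andP[x1 x2]; elim: n phi psi => [|n IH] phi psi le_phi.
  by rewrite !bernstein0 le_phi.
rewrite !bernsteinS lerD// ler_wpM2l; try lra.
  by apply: IH => k kn; apply: le_phi; exact: leqW.
by apply: IH => k kn; exact: le_phi.
Qed.

(** Second moment about [c] of the binomial law with [t = (1 + x) / 2]: squared bias plus the
    variance [n t (1 - t)]. The centre is arbitrary because the shift of [k] in the induction
    replaces [c] by [c - 1]. *)
Lemma bernstein_affine_sqr n (a b c : R) x :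
  (bernstein n (fun k => a + b * (k%:R - c) ^+ 2)).[x] =
  a + b * ((n%:R * ((1 + x) / 2) - c) ^+ 2
           + n%:R * ((1 + x) / 2) * (1 - (1 + x) / 2)).
Proof.
elim: n c => [|n IH] c; first by rewrite bernstein0; ring.
rewrite bernsteinS IH.
have -> : (fun k => a + b * (k%:R - c) ^+ 2) \o succn =
    (fun k => a + b * (k%:R - (c - 1)) ^+ 2).
  by apply/funext => k /=; rewrite -addn1 natrD; ring.
by rewrite IH -[n.+1]addn1 natrD; field.
Qed.

(** Heine-Cantor, from the near-covering form of compactness with [d] tending to 0 from the
    right. *)
Lemma uniform_continuous_itv G (a b : R) : {within `[a, b], continuous G} ->
  forall eps, 0 < eps -> exists2 d, 0 < d &
    {in `[a, b] &, forall x y, `|x - y| < d -> `|G x - G y| < eps}.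
Proof.
move=> /subspace_continuousP cG eps eps0.
have := @segment_compact R a b; rewrite compact_near_coveringP => ncov.
pose P (d y : R) := y \in `[a, b] -> {in `[a, b], forall z, `|y - z| < d -> `|G y - G z| < eps}.
have : \forall d \near 0^'+, `[a, b] `<=` P d.
  apply: ncov => x xab.
  have e2 : 0 < eps / 2 by rewrite divr_gt0.
  have /cvgrPdist_lt/(_ _ e2)[r /= r0 hr] := cG x xab.
  have r2 : 0 < r / 2 by rewrite divr_gt0.
  exists (ball x (r / 2), [set d | 0 < d < r / 2]).
    split => /=; first exact: nbhsx_ballx.
    near=> d; apply/andP; split; near: d; [exact: nbhs_right_gt|exact: nbhs_right_lt].
  move=> [y d] /= [yx /andP[d0 dr]] yab z zab yz.
  have xy : `|x - y| < r / 2 by [].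
  have Gy : `|G x - G y| < eps / 2.
    by apply: hr => //=; rewrite (lt_trans xy)// ltr_pdivrMr// ltr_pMr// ltr1n.
  have Gz : `|G x - G z| < eps / 2.
    apply: hr => //=; rewrite (splitr r) (le_lt_trans (ler_distD y _ _))// ltrD//.
    exact: lt_trans dr.
  rewrite (splitr eps) (le_lt_trans (ler_distD (G x) _ _))// ltrD//.
  by rewrite distrC.
move=> /(filterI (nbhs_right_gt (0 : R)))/filter_ex[d [d0 Pd]].
by exists d => // x y xab yab xy; exact: Pd.
Unshelve. all: by end_near. Qed.

(** Close points fall under uniform continuity; for [|x - y| >= d] the bound [2 M] is at most
    [2 M (x - y)^2 / d^2]. A quadratic majorant is what [bernstein_affine_sqr] evaluates exactly. *)
Lemma continuous_sqr_modulus G (a b : R) : {within `[a, b], continuous G} ->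
  forall eps, 0 < eps -> exists2 C, 0 <= C &
    {in `[a, b] &, forall x y, `|G x - G y| <= eps + C * (x - y) ^+ 2}.
Proof.
move=> cG eps eps0; have [d d0 hd] := uniform_continuous_itv cG eps0.
have [M M0 hM] : exists2 M, 0 <= M & {in `[a, b], forall x, `|G x| <= M}.
  have /compact_bounded[M [_ hM]] : compact (G @` `[a, b]).
    by apply: continuous_compact => //; exact: segment_compact.
  exists (`|M| + 1); first by rewrite addr_ge0.
  move=> x xab; apply: hM; last by exists x.
  by rewrite ltr_pwDr// ler_norm.
exists (2 * M / d ^+ 2); first by rewrite divr_ge0 ?sqr_ge0// mulr_ge0.
move=> x y xab yab; have [xy|xy] := ltP `|x - y| d.
  rewrite (le_trans (ltW (hd _ _ xab yab xy)))// lerDl.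
  by rewrite mulr_ge0 ?sqr_ge0// divr_ge0 ?sqr_ge0// mulr_ge0.
have le1 : 1 <= (x - y) ^+ 2 / d ^+ 2.
  rewrite ler_pdivlMr ?exprn_gt0// mul1r -(real_normK (num_real (x - y))).
  by rewrite lerXn2r ?nnegrE ?(ltW d0).
have -> : 2 * M / d ^+ 2 * (x - y) ^+ 2 = 2 * M * ((x - y) ^+ 2 / d ^+ 2) by ring.
have : 2 * M <= 2 * M * ((x - y) ^+ 2 / d ^+ 2) by rewrite ler_peMr// mulr_ge0.
have := ler_normB (G x) (G y); have := hM x xab; have := hM y yab.
lra.
Qed.

Lemma weierstrass G : {within `[-1, 1], continuous G} ->
  forall eps, 0 < eps -> exists p : {poly R},
    {in `[-1, 1], forall x, `|G x - p.[x]| <= eps}.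
Proof.
move=> cG eps eps0; have e2 : 0 < eps / 2 by rewrite divr_gt0.
have [C C0 hC] := continuous_sqr_modulus cG e2.
(* The variance term will be [C (1 - x^2) / N], and this choice makes it at most [eps / 2]. *)
have [n nC] : exists n, 2 * C / eps < n.+1%:R.
  by exists (Num.truncn (2 * C / eps)); exact: truncnS_gt.
pose N : R := n.+1%:R; have N0 : 0 < N by rewrite ltr0n.
pose phi k := G (2 / N * k%:R - 1).
exists (bernstein n.+1 phi) => x; rewrite in_itv/= => x11.
have /andP[x1 x2] := x11.
have phi_le k : (k <= n.+1)%N ->
    `|phi k - G x| <= eps / 2 + (4 * C / N ^+ 2) * (k%:R - N * ((1 + x) / 2)) ^+ 2.
  move=> kn; have kN : k%:R <= N by rewrite ler_nat.
  have k0 : 0 <= k%:R :> R by [].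
  have := hC (2 / N * k%:R - 1) x; rewrite !in_itv/= x11.
  have -> : 4 * C / N ^+ 2 * (k%:R - N * ((1 + x) / 2)) ^+ 2 =
      C * (2 / N * k%:R - 1 - x) ^+ 2 by field; rewrite gt_eqF.
  apply=> //; rewrite lerBlDr lerBrDr mulrAC.
  rewrite ler_pdivrMr// ler_pdivlMr//; apply/andP; split; lra.
have b_le := bernstein_affine_sqr n.+1.
have bound : (4 * C / N ^+ 2) * (N * ((1 + x) / 2) * (1 - (1 + x) / 2)) <= eps / 2.
  have -> : (4 * C / N ^+ 2) * (N * ((1 + x) / 2) * (1 - (1 + x) / 2)) =
    C * (1 - x ^+ 2) / N by field; rewrite gt_eqF.
  rewrite ler_pdivrMr//; move: nC; rewrite ltr_pdivrMr// => nC.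
  have : C * (1 - x ^+ 2) <= C by rewrite ler_piMr// gerBl sqr_ge0.
  by rewrite -/N in nC; lra.
move: (4 * C / N ^+ 2) phi_le bound => K phi_le bound.
(* By monotonicity the Bernstein polynomial of [phi] lies between those of two parabolas centred at
   the binomial mean [N (1 + x) / 2], where only the variance remains. *)
rewrite distrC ler_distl; apply/andP; split.
- have := @le_bernstein n.+1 (fun k => (G x - eps / 2) +
    (- K) * (k%:R - N * ((1 + x) / 2)) ^+ 2) phi x x11.
  rewrite b_le -/N subrr expr0n/= add0r => h.
  have {}h := h _; apply: le_trans (h _); first by lra.
  by move=> k /phi_le; rewrite ler_distl => /andP[? ?]; lra.
- have := @le_bernstein n.+1 phi (fun k => (G x + eps / 2) +
    K * (k%:R - N * ((1 + x) / 2)) ^+ 2) x x11.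
  rewrite b_le -/N subrr expr0n/= add0r => h.
  apply: le_trans (h _) _; last by lra.
  by move=> k /phi_le; rewrite ler_distl => /andP[? ?]; lra.
Qed.

End Weierstrass.

(** * Uniform trigonometric approximation away from the zeros of the sine *)

Section TrigonometricApproximation.
Context {R : realType}.
Variables (gamma : R) (hgamma : - 2^-1 < gamma).
Local Notation w := (theta_weight gamma).
Implicit Types (H : R -> R) (x M : R) (p q : {poly R}) (n : nat).

Definition clamp M x : R := Num.max (- M) (Num.min M x).

Lemma continuous_clamp M H : continuous H -> continuous (fun x => clamp M (H x)).
Proof.
move=> cH x; apply: (@continuous_max R R (cst (- M)) (fun y => Num.min M (H y))); first exact: cvg_cst.
by apply: (@continuous_min R R (cst M) H); [exact: cvg_cst|exact: cH].
Qed.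

Lemma clamp_id M x : `|x| <= M -> clamp M x = x.
Proof.
by rewrite ler_norml => /andP[x1 x2]; rewrite /clamp min_r// max_r.
Qed.

Lemma norm_clamp_le M x : 0 <= M -> `|clamp M x| <= M.
Proof.
move=> M0; rewrite ler_norml /clamp le_max lexx/= ge_max.
by rewrite ge_min lexx/= (le_trans _ M0)// oppr_le0.
Qed.

Lemma clamp_lipschitz M x (y : R) : 0 <= M -> `|clamp M x - clamp M y| <= `|x - y|.
Proof.
move=> M0; have b1 : x - y <= `|x - y| by exact: ler_norm.
have b2 : y - x <= `|x - y| by rewrite distrC ler_norm.
move: `|x - y| b1 b2 => B b1 b2; rewrite ler_norml /clamp.
by case: (leP M x) => ?; case: (leP M y) => ?;
  do ![case: (leP (- M) _) => ?]; apply/andP; split; lra.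
Qed.

(** Clamping as a contraction factor: a further cutoff then just multiplies the factors, which gives
    [truncation_sqr_dist]. *)
Lemma clamp_scale M x : 0 <= M -> exists2 t, 0 <= t <= 1 & clamp M x = t * x.
Proof.
move=> M0; have [xM|Mx] := leP `|x| M.
  by exists 1; rewrite ?ler01 ?lexx// clamp_id// mul1r.
have x0 : 0 < `|x| by exact: le_lt_trans Mx.
exists (M / `|x|).
  by rewrite divr_ge0 ?(ltW x0)//= ler_pdivrMr// mul1r ltW.
move: Mx x0; rewrite /clamp; case: (ger0P x) => xs Mx x0.
  by rewrite min_l ?(ltW Mx)// max_r ?divfK ?gt_eqF//; lra.
rewrite min_r; last by lra.
rewrite max_l; last by lra.
by rewrite invrN mulrN mulNr divfK// lt_eqF.
Qed.

(** For positive [n]: piecewise linear, 0 up to [1/n] and 1 from [2/n] on. *)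
Definition cutoff n x : R := Num.min 1 (Num.max 0 (n%:R * x - 1)).

Lemma cutoff_itv n x : 0 <= cutoff n x <= 1.
Proof.
by rewrite /cutoff le_min ler01 le_max lexx/= ge_min lexx.
Qed.

Lemma cutoff_neq0 n x : cutoff n x != 0 -> 1 < n%:R * x.
Proof.
apply: contraNT; rewrite -leNgt => nx.
by rewrite /cutoff max_l ?subr_le0// min_r.
Qed.

Lemma cutoff_eq1 n x : 2 <= n%:R * x -> cutoff n x = 1.
Proof.
move=> nx; rewrite /cutoff max_r ?min_l//; lra.
Qed.

Lemma continuous_cutoff n H x : {for x, continuous H} ->
  {for x, continuous (fun y => cutoff n (H y))}.
Proof.
move=> cH; apply: (@continuous_min R R (cst 1) (fun y => Num.max 0 (n%:R * H y - 1))); first exact: cvg_cst.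
apply: (@continuous_max R R (cst 0) (fun y => n%:R * H y - 1)); first exact: cvg_cst.
apply: cvgB; last exact: cvg_cst.
by apply: cvgM; [exact: cvg_cst|exact: cH].
Qed.

Lemma trig_uniform_approx H n eps : (0 < n)%N -> continuous H -> 0 < eps ->
  exists p q, {in `[-pi, pi], forall x,
    (H x * cutoff n (sin x ^+ 2) - trig_poly p q x * Num.sqrt (w x)) ^+ 2
      <= eps ^+ 2 * w x}.
Proof.
move=> n0 cH eps0; have n0' : 0 < n%:R :> R by rewrite ltr0n.
(* [S (cos x)] is the cutoff divided by the square root of [w], and [D (cos x)] is [|sin x|] where
   the cutoff is nonzero. The maxima keep both bases positive, hence everything continuous, without
   changing values there: [1/n < 1 - y^2 <= 2 (1 + y)]. *)
pose S (y : R) : R := cutoff n (1 - y ^+ 2) * Num.max (1 + y) (2 * n%:R)^-1 `^ (- (gamma / 2)).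
pose D (y : R) : R := Num.sqrt (Num.max (1 - y ^+ 2) n%:R^-1).
have cS (y : R) : {for y, continuous S}.
  apply: cvgM.
    apply: (@continuous_cutoff n (fun y => 1 - y ^+ 2)); apply: cvgB; first exact: cvg_cst.
    by apply: cvgM; exact: cvg_id.
  apply: (@continuous_powR_comp _ (fun y => Num.max (1 + y) (2 * n%:R)^-1)).
    apply: (@continuous_max R R _ (cst _) y); last exact: cvg_cst.
    by apply: cvgD; [exact: cvg_cst|exact: cvg_id].
  by rewrite lt_max invr_gt0 mulr_gt0 ?orbT.
have cD (y : R) : {for y, continuous (fun y => (D y)^-1)}.
  have cD' : {for y, continuous D}.
    apply: (@continuous_comp R R R (fun y : R => Num.max (1 - y ^+ 2) n%:R^-1) Num.sqrt y).
      apply: (@continuous_max R R _ (cst _) y); last exact: cvg_cst.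
      apply: cvgB; first exact: cvg_cst.
      by apply: cvgM; exact: cvg_id.
    exact: sqrt_continuous.
  apply: cvgV; last exact: cD'.
  by rewrite sqrtr_eq0 -ltNge lt_max invr_gt0 n0' orbT.
pose E (y : R) : R := (H (acos y) + H (- acos y)) / 2 * S y.
pose O (y : R) : R := (H (acos y) - H (- acos y)) / 2 * S y * (D y)^-1.
have cHa : {within `[-1, 1], continuous (fun y => H (acos y))}.
  apply: (within_continuous_compS (B := setT) continuous_within_acos) => //.
  exact: continuous_subspaceT.
have cHNa : {within `[-1, 1], continuous (fun y => H (- acos y))}.
  apply: (within_continuous_compS (B := setT) (g := fun y => H (- y))
    continuous_within_acos) => //.
  by apply: continuous_subspaceT; exact: continuous_opp.
have cSw : {within `[-1, 1], continuous S} by exact: continuous_subspaceT.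
have cDw : {within `[-1, 1], continuous (fun y => (D y)^-1)}.
  exact: continuous_subspaceT.
have cE : {within `[-1, 1], continuous E}.
  move=> y; apply: cvgM; last exact: cSw.
  by apply: cvgM; [apply: cvgD; [exact: cHa|exact: cHNa]|exact: cvg_cst].
have cO : {within `[-1, 1], continuous O}.
  move=> y; apply: cvgM; last exact: cDw.
  apply: cvgM; last exact: cSw.
  by apply: cvgM; [apply: cvgB; [exact: cHa|exact: cHNa]|exact: cvg_cst].
have e2 : 0 < eps / 2 by rewrite divr_gt0.
have [p hp] := weierstrass cE e2; have [q hq] := weierstrass cO e2.
exists p, q => x xpi; have c11 : cos x \in `[-1, 1].
  by rewrite in_itv/= cos_geN1 cos_le1.
have nsin : 1 < n%:R * (1 - cos x ^+ 2) -> n%:R^-1 < 1 - cos x ^+ 2.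
  by move=> h; rewrite -(ltr_pM2l n0') mulfV// gt_eqF.
have sD : S (cos x) * (D (cos x))^-1 * `|sin x| = S (cos x).
  have [c0|/cutoff_neq0/nsin c1] := eqVneq (cutoff n (1 - cos x ^+ 2)) 0.
    by rewrite /S c0 !mul0r.
  rewrite /D max_l ?(ltW c1)// -sin2cos2 sqrtr_sqr divfK//.
  rewrite normr_eq0; apply/eqP => s0; move: c1; rewrite -sin2cos2 s0 expr0n/=.
  by rewrite ltNge invr_ge0 ltW.
(* For [x < 0] one has [acos (cos x) = - x]: the two values of [H] are exchanged, and
   [|sin x| = - sin x] restores the sign. *)
have EO : E (cos x) + sin x * O (cos x) = H x * S (cos x).
  have [x0|x0] := leP 0 x.
    have xp : 0 <= x <= pi by move: xpi; rewrite !in_itv/= x0 => /andP[].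
    have := sD; rewrite ger0_norm ?sin_ge0_pi// /E /O cosK ?in_itv//= => sD'.
    transitivity ((H x + H (- x)) / 2 * S (cos x) +
      (H x - H (- x)) / 2 * (S (cos x) / D (cos x) * sin x)); first by ring.
    by rewrite sD'; field.
  have xp : - pi <= x <= 0 by move: xpi; rewrite !in_itv/= (ltW x0) => /andP[->].
  have sN : `|sin x| = - sin x.
    rewrite -normrN -sinN ger0_norm// sin_ge0_pi//.
    by move: xp => /andP[? ?]; apply/andP; split; lra.
  have := sD; rewrite sN /E /O cosKN// opprK => sD'.
  transitivity ((H (- x) + H x) / 2 * S (cos x) -
    (H (- x) - H x) / 2 * (S (cos x) / D (cos x) * - sin x)); first by ring.
  by rewrite sD'; field.
have HS : H x * cutoff n (sin x ^+ 2) = H x * S (cos x) * Num.sqrt (w x).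
  rewrite -mulrA sin2cos2 /S; congr (_ * _).
  have [->|/cutoff_neq0 c1] := eqVneq (cutoff n (1 - cos x ^+ 2)) 0.
    by rewrite !mul0r.
  have c2 : (2 * n%:R)^-1 < 1 + cos x.
    rewrite -(@ltr_pM2l _ (2 * n%:R)) ?mulr_gt0// mulfV ?mulf_neq0 ?gt_eqF//.
    rewrite (lt_le_trans c1)// mulrAC [leRHS]mulrC ler_pM2l//.
    have -> : 1 - cos x ^+ 2 = (1 - cos x) * (1 + cos x) by ring.
    by rewrite ler_wpM2r ?cosD1_ge0//; have := cos_geN1 x; lra.
  have c0 : 0 < 1 + cos x by apply: lt_trans c2; rewrite invr_gt0 mulr_gt0.
  rewrite max_l ?(ltW c2)// -mulrA /theta_weight -powR12_sqrt ?powR_ge0//.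
  by rewrite -powRrM powRN mulVf ?mulr1// gt_eqF// powR_gt0.
have TE : `|E (cos x) + sin x * O (cos x) - trig_poly p q x| <= eps.
  have -> : E (cos x) + sin x * O (cos x) - trig_poly p q x =
      (E (cos x) - p.[cos x]) + sin x * (O (cos x) - q.[cos x]).
    by rewrite /trig_poly; ring.
  rewrite (splitr eps) (le_trans (ler_normD _ _))// lerD ?hp// normrM.
  rewrite (le_trans _ (hq _ c11))// ler_piMl//.
  by rewrite ler_norml sin_geN1 sin_le1.
rewrite HS -EO -mulrBl exprMn sqr_sqrtr ?theta_weight_ge0//.
rewrite ler_wpM2r ?theta_weight_ge0// -(real_normK (num_real (_ - _))).
by rewrite lerXn2r ?nnegrE// ltW.
Qed.

End TrigonometricApproximation.

(** * Density of trigonometric polynomials in the real weighted space *)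

Section Density.
Context {R : realType}.
Variables (gamma : R) (hgamma : - 2^-1 < gamma).
Local Notation w := (theta_weight gamma).
Local Notation mu := (@lebesgue_measure R).
Local Notation I := (`[-pi, pi]%classic : set R).
Implicit Types (h H : R -> R) (x M : R) (p q : {poly R}) (n : nat).

Lemma continuous_trig_poly p q : continuous (trig_poly p q).
Proof.
move=> x; apply: cvgD; first exact/cvg_horner_comp/continuous_cos.
apply: cvgM; first exact: continuous_sin.
exact/cvg_horner_comp/continuous_cos.
Qed.

Lemma sin_neq0 x : x \in `]-pi, pi[ -> x != 0 -> sin x != 0.
Proof.
rewrite in_itv/= => /andP[x1 x2]; case: (ltgtP x 0) => // x0 _.
  by rewrite lt_eqF// -oppr_gt0 -sinN sin_gt0_pi// oppr_gt0 x0 ltrNl.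
by rewrite gt_eqF// sin_gt0_pi// x0.
Qed.

Definition truncation n h x : R := clamp n%:R (h x) * cutoff n (sin x ^+ 2).

Lemma truncation_sqr_dist n h x : (h x - truncation n h x) ^+ 2 <= h x ^+ 2.
Proof.
have [t /andP[t0 t1] tE] := clamp_scale (h x) (ler0n R n).
have /andP[c0 c1] := cutoff_itv n (sin x ^+ 2).
rewrite /truncation tE; move: (cutoff _ _) c0 c1 => c c0 c1.
have -> : h x - t * h x * c = (1 - t * c) * h x by ring.
rewrite exprMn ler_piMl ?sqr_ge0// exprn_ile1 ?subr_ge0 ?mulr_ile1//.
by rewrite gerBl mulr_ge0.
Qed.

Lemma truncation_cvg h x : sin x != 0 ->
  \forall n \near \oo, truncation n h x = h x.
Proof.
move=> s0; have s2 : 0 < sin x ^+ 2 by rewrite exprn_even_gt0.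
near=> n.
rewrite /truncation clamp_id ?cutoff_eq1 ?mulr1//.
  rewrite -ler_pdivrMr//; near: n; exact: nbhs_infty_ger.
by near: n; exact: nbhs_infty_ger.
Unshelve. all: by end_near. Qed.

Lemma measurable_truncation n h : measurable_fun I h ->
  measurable_fun I (truncation n h).
Proof.
move=> mh; apply: measurable_funM.
  apply: measurable_maxr; first exact: measurable_cst.
  by apply: measurable_minr => //; exact: measurable_cst.
apply: measurable_funTS; apply: continuous_measurable_fun => x.
apply: (@continuous_cutoff R n (fun y => sin y ^+ 2)).
by apply: cvgM; exact: continuous_sin.
Qed.

Lemma truncation_L2_cvg h : measurable_fun I h ->
  mu.-integrable I (fun x => (h x ^+ 2)%:E) ->
  (\int[mu]_(x in I) ((h x - truncation n h x) ^+ 2)%:E)%E @[n --> \oo] --> 0%E.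
Proof.
move=> mh ih.
pose f n x := ((h x - truncation n h x) ^+ 2)%:E.
have mf n : measurable_fun I (f n).
  apply/measurable_EFinP/measurable_funX/measurable_funB => //.
  exact: measurable_truncation.
have f0 : {ae mu, forall x, I x -> f n x @[n --> \oo] --> 0%E}.
  (* The exceptional set consists of the zeros of the sine in [I]. *)
  exists [set -pi; 0; pi]; split.
  - by apply: measurableU; [apply: measurableU|]; exact: measurable_set1.
  - apply: countable_lebesgue_measure0; apply: finite_set_countable.
    by rewrite !finite_setU.
  - move=> x /=; apply: contra_notP => /not_orP[/not_orP[x1 x0] x2] xI.
    have s0 : sin x != 0.
      apply: sin_neq0; last exact/eqP.
      move: xI; rewrite !in_itv/= !le_eqVlt => /andP[/predU1P[/esym//|->]].
      by move=> /predU1P[//|->].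
    apply: cvg_near_cst; near=> n; rewrite /f.
    have -> : truncation n h x = h x by near: n; exact: truncation_cvg.
    by rewrite subrr expr0n.
have fg : {ae mu, forall x n, I x -> (`|f n x| <= (h x ^+ 2)%:E)%E}.
  apply: aeW => x n _; rewrite /f /= ger0_norm ?sqr_ge0// lee_fin.
  exact: truncation_sqr_dist.
have [_ _] := @dominated_convergence _ _ _ mu I (measurable_itv _) f (cst 0%E)
  (fun x => (h x ^+ 2)%:E) mf (measurable_cst _) f0 ih fg.
by rewrite integral0.
Unshelve. all: by end_near. Qed.

Lemma trig_dense h : measurable_fun I h ->
  mu.-integrable I (fun x => (h x ^+ 2 * w x)%:E) ->
  forall eps, 0 < eps -> exists p q,
    mu.-integrable I (fun x => ((h x - trig_poly p q x) ^+ 2 * w x)%:E) /\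
    \int[mu]_(x in I) ((h x - trig_poly p q x) ^+ 2 * w x) < eps.
Proof.
move=> mh ih eps eps0.
have iw := integrable_theta_weight hgamma.
have mw : measurable_fun I w by case/integrableP : iw => /measurable_EFinP.
pose g x := h x * Num.sqrt (w x).
have mg : measurable_fun I g.
  apply: measurable_funM => //; apply: measurableT_comp => //.
  apply: continuous_measurable_fun; exact: sqrt_continuous.
have g2 x : g x ^+ 2 = h x ^+ 2 * w x.
  by rewrite exprMn sqr_sqrtr// theta_weight_ge0.
have ig : mu.-integrable I (fun x => (g x ^+ 2)%:E).
  by have -> : (fun x => (g x ^+ 2)%:E) = (fun x => (h x ^+ 2 * w x)%:E)
    by apply/funext => x; rewrite g2.
have muI : (mu I < +oo)%E.
  by rewrite lebesgue_measure_itv/=; case: ifP => _; rewrite ?ltry.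
(* Three errors, each weighted by 3 through [(u + v + z)^2 <= 3 (u^2 + v^2 + z^2)]. *)
have e9 : 0 < eps / 9 by rewrite divr_gt0.
have [n n0 hn] : exists2 n, (0 < n)%N &
    (\int[mu]_(x in I) ((g x - truncation n g x) ^+ 2)%:E < (eps / 9)%:E)%E.
  have /fine_cvgP[fin lim0] := truncation_L2_cvg mg ig.
  move: lim0 => /cvgr0Pnorm_lt/(_ _ e9) near_lt.
  have [n [[fn ltn] n0]] := filter_ex (filterI (filterI fin near_lt) (nbhs_infty_gt 0)).
  exists n => //; rewrite -(fineK fn) lte_fin.
  exact: le_lt_trans (ler_norm _) ltn.
pose c x := clamp n%:R (g x).
have mc : measurable_fun I c.
  apply: measurable_maxr; first exact: measurable_cst.
  by apply: measurable_minr => //; exact: measurable_cst.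
have ic : mu.-integrable I (EFin \o c).
  apply: measurable_bounded_integrable => //.
  exists n%:R; split => // M nM x _ /=.
  by rewrite (le_trans (norm_clamp_le _ _))// ltW.
(* An [L^1] approximation suffices: after clamping [H], both functions are bounded by [n], so the
   squared difference is at most [2 n |c - H|]. *)
have [H [cH iH hH]] : exists H, [/\ continuous H, mu.-integrable I (EFin \o H) &
   (\int[mu]_(x in I) `|(c x - H x)%:E| < (eps / 9 / (2 * n%:R))%:E)%E].
  have [H_ [cH iH limH]] :=
    approximation_continuous_integrable (measurable_itv _) muI ic.
  have e18 : 0 < eps / 9 / (2 * n%:R) by rewrite !divr_gt0// mulr_gt0 ?ltr0n.
  move: limH => /fine_cvgP[fin lim0].
  move: lim0 => /cvgr0Pnorm_lt/(_ _ e18) near_lt.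
  have [m [fm ltm]] := filter_ex (filterI fin near_lt).
  exists (H_ m); split => //; rewrite -(fineK fm) lte_fin.
  exact: le_lt_trans (ler_norm _) ltm.
pose W := \int[mu]_(x in I) w x.
have W0 : 0 <= W by apply: Rintegral_ge0 => x _; exact: theta_weight_ge0.
(* Chosen so that [d^2 W < eps / 9]; the summand 1 keeps the denominator positive. *)
pose d := Num.sqrt (eps / 9 / (W + 1)).
have d0 : 0 < d by rewrite sqrtr_gt0 divr_gt0// ltr_wpDl.
have cK : continuous (fun x => clamp n%:R (H x)) by exact: continuous_clamp.
have [p [q hpq]] := trig_uniform_approx gamma n0 cK d0.
exists p, q.
pose B x := 3 * ((g x - truncation n g x) ^+ 2) + 3 * (2 * n%:R * `|c x - H x|)
   + 3 * (d ^+ 2 * w x).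
have le_B x : x \in I -> (h x - trig_poly p q x) ^+ 2 * w x <= B x.
  move=> /set_mem/= xI; have := hpq x xI; rewrite /B.
  set K := clamp n%:R (H x); set T := trig_poly p q x.
  have -> : (h x - T) ^+ 2 * w x = (g x - T * Num.sqrt (w x)) ^+ 2.
    by rewrite -mulrBl exprMn sqr_sqrtr// theta_weight_ge0.
  move: (T * _) (d ^+ 2 * w x) => S D hD.
  have cE : clamp n%:R (c x) = c x by rewrite clamp_id// norm_clamp_le.
  have le1 : `|c x - K| <= `|c x - H x| by rewrite -{1}cE clamp_lipschitz.
  have le2 : `|c x - K| <= 2 * n%:R.
    rewrite mulr_natl mulr2n (le_trans (ler_normB _ _))// lerD//;
      exact: norm_clamp_le.
  have sq : (c x - K) ^+ 2 <= 2 * n%:R * `|c x - H x|.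
    by rewrite -(real_normK (num_real _)) expr2 ler_pM.
  rewrite /truncation -/(c x); have /andP[k0 k1] := cutoff_itv n (sin x ^+ 2).
  move: (cutoff _ _) k0 k1 hD => k k0 k1 hD.
  have sqk : ((c x - K) * k) ^+ 2 <= 2 * n%:R * `|c x - H x|.
    rewrite exprMn (le_trans _ sq)// ler_piMr ?sqr_ge0//.
    by rewrite exprn_ile1.
  (* The three errors: truncation, continuous approximation, trigonometric approximation. *)
  have -> : g x - S = (g x - c x * k) + (c x - K) * k + (K * k - S) by ring.
  move: (g x - _) ((c x - K) * k) (K * k - S) sqk hD => u v z.
  move: (2 * _ * _) => V vV zD.
  (* Certificate for [nra]: these three squares add up to [3 (u^2 + v^2 + z^2) - (u + v + z)^2]. *)
  have : 0 <= (u - v) ^+ 2 by exact: sqr_ge0.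
  have : 0 <= (u - z) ^+ 2 by exact: sqr_ge0.
  have : 0 <= (v - z) ^+ 2 by exact: sqr_ge0.
  by move: vV zD; nra.
have i1 : mu.-integrable I (fun x => ((g x - truncation n g x) ^+ 2)%:E).
  apply: le_integrable ig => //.
    apply/measurable_EFinP/measurable_funX/measurable_funB => //.
    exact: measurable_truncation.
  move=> x _; rewrite lee_fin !ger0_norm ?sqr_ge0//.
  exact: truncation_sqr_dist.
have i2 : mu.-integrable I (fun x => (`|c x - H x|)%:E).
  by apply: integrable_norm => //; exact: integrableB ic iH.
have i2' : mu.-integrable I (fun x => (2 * n%:R * `|c x - H x|)%:E).
  exact: (integrableZl _ (2 * n%:R) i2).
have i3 : mu.-integrable I (fun x => (d ^+ 2 * w x)%:E).
  exact: (integrableZl _ (d ^+ 2) iw).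
have i1_3 : mu.-integrable I (fun x => (3 * (g x - truncation n g x) ^+ 2)%:E).
  exact: (integrableZl _ 3 i1).
have i2_3 : mu.-integrable I (fun x => (3 * (2 * n%:R * `|c x - H x|))%:E).
  exact: (integrableZl _ 3 i2').
have i3_3 : mu.-integrable I (fun x => (3 * (d ^+ 2 * w x))%:E).
  exact: (integrableZl _ 3 i3).
have i12 : mu.-integrable I (fun x => (3 * (g x - truncation n g x) ^+ 2 +
    3 * (2 * n%:R * `|c x - H x|))%:E).
  exact: (integrableD _ i1_3 i2_3).
have iB : mu.-integrable I (EFin \o B) by exact: (integrableD _ i12 i3_3).
have iT : mu.-integrable I (fun x => ((h x - trig_poly p q x) ^+ 2 * w x)%:E).
  apply: le_integrable iB => //.
    apply/measurable_EFinP/measurable_funM => //.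
    apply/measurable_funX/measurable_funB => //.
    apply: measurable_funTS; apply: continuous_measurable_fun.
    exact: continuous_trig_poly.
  move=> x Ix; rewrite lee_fin ger0_norm; last first.
    by rewrite mulr_ge0 ?sqr_ge0 ?theta_weight_ge0.
  by rewrite (le_trans (le_B x (mem_set Ix)))// ler_norm.
split=> //; apply: (@le_lt_trans _ _ (\int[mu]_(x in I) B x)).
  by apply: le_Rintegral => // x Ix; apply: le_B; exact: mem_set.
rewrite RintegralD// RintegralD// !RintegralZl// -/W.
have v1 : \int[mu]_(x in I) ((g x - truncation n g x) ^+ 2) < eps / 9.
  by rewrite -lte_fin /Rintegral fineK// integrable_fin_num.
have v2 : 2 * n%:R * \int[mu]_(x in I) `|c x - H x| < eps / 9.
  have n2 : 0 < 2 * n%:R :> R by rewrite mulr_gt0 ?ltr0n.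
  rewrite mulrC -ltr_pdivlMr// -lte_fin /Rintegral fineK//.
  exact: integrable_fin_num.
have v3 : d ^+ 2 * W < eps / 9.
  rewrite sqr_sqrtr; last by rewrite divr_ge0 ?addr_ge0// ltW.
  by rewrite mulrAC ltr_pdivrMr ?ltr_wpDl// ltr_pM2l// ltrDl.
have sum9 (u1 u2 u3 : R) : u1 < eps / 9 -> u2 < eps / 9 -> u3 < eps / 9 ->
  3 * u1 + 3 * u2 + 3 * u3 < eps by clear -eps0; lra.
exact: sum9.
Qed.

End Density.

(** * The span of the [Psi] and completeness *)

Section Completeness.
Context {R : realType}.
Variables (gamma : R) (hgamma : - 2^-1 < gamma).
Local Notation w := (theta_weight gamma).
Local Notation mu := (@lebesgue_measure R).
Local Notation I := (`[-pi, pi]%classic : set R).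
Local Notation P := (normalized_jacobi gamma 0).
Local Notation Q := (normalized_jacobi gamma 1).
Implicit Types (x : R) (p q : {poly R}) (n : nat) (k : int).

Lemma finite_span_Psi_trig g : finite_span (Psi gamma) g ->
  exists p1 q1 p2 q2, g = fun x => (trig_poly p1 q1 x +i* trig_poly p2 q2 x)%C.
Proof.
move=> [s [c gE]].
suff [p1 [q1 [p2 [q2 E]]]] : exists p1 q1 p2 q2, forall x,
    \sum_(k <- s) c k * Psi gamma k x =
    (trig_poly p1 q1 x +i* trig_poly p2 q2 x)%C.
  by exists p1, q1, p2, q2; apply/funext => x; rewrite gE E.
elim: s {gE} => [|k s [p1 [q1 [p2 [q2 IH]]]]].
  exists 0, 0, 0, 0 => x.
  by rewrite big_nil /trig_poly !horner0 mulr0 addr0.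
case cE: (c k) => [a b].
exists (a *: Psi_even gamma k + p1), (- b *: Psi_odd gamma k + q1),
  (b *: Psi_even gamma k + p2), (a *: Psi_odd gamma k + q2) => x.
rewrite big_cons IH PsiE cE /trig_poly.
move: (Psi_even gamma k) (Psi_odd gamma k) => A B.
rewrite !(hornerD, hornerZ, hornerN).
apply/eqP; rewrite eq_complex /=.
by apply/andP; split; apply/eqP; ring.
Qed.

Lemma Psi_posz n x : Psi gamma n.+1%:Z x =
  (2^-1 * (P n.+1).[cos x] +i* (sin x * (2^-1 * (Q n).[cos x])))%C.
Proof.
rewrite PsiE /Psi_even /Psi_odd /=; move: (P n.+1) (Q n) => p q.
by rewrite !hornerZ mulr1.
Qed.

Lemma Psi_negz n x : Psi gamma (Negz n) x =
  (2^-1 * (P n.+1).[cos x] +i* (- (sin x * (2^-1 * (Q n).[cos x]))))%C.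
Proof.
rewrite PsiE /Psi_even /Psi_odd /=; move: (P n.+1) (Q n) => p q.
by rewrite !hornerZ mulrN1 mulNr mulrN.
Qed.

Lemma trig_finite_span_Psi p1 q1 p2 q2 :
  finite_span (Psi gamma)
    (fun x => (trig_poly p1 q1 x +i* trig_poly p2 q2 x)%C).
Proof.
(* [Psi] pairs [P n.+1] with [Q n], so the even parts are expanded over [N.+1] polynomials and the
   odd parts over [N]. *)
pose N := maxn (maxn (size p1) (size p2)) (maxn (size q1) (size q2)).
have [s1 s2 s3 s4] : [/\ (size p1 <= N.+1)%N, (size p2 <= N.+1)%N,
    (size q1 <= N)%N & (size q2 <= N)%N].
  by rewrite /N; split; rewrite ?leqW// !leq_max leqnn ?orbT.
have [a1 a1E] := poly_basis_span (size_normalized_jacobi hgamma 0) s1.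
have [a2 a2E] := poly_basis_span (size_normalized_jacobi hgamma 0) s2.
have [b1 b1E] := poly_basis_span (size_normalized_jacobi hgamma 1) s3.
have [b2 b2E] := poly_basis_span (size_normalized_jacobi hgamma 1) s4.
(* For opposite indices [n.+1] and [Negz n], the sum of the two functions is [P n.+1] and the
   difference is [i sin Q n], both at the cosine. Hence the coefficient [b1 + i b2] of [sin Q n]
   enters as [b2 - i b1], with opposite signs for the two indices. *)
pose c k : R[i] := match k with
  | Posz 0 => (Num.sqrt 2 * a1 0%N +i* (Num.sqrt 2 * a2 0%N))%C
  | Posz n.+1 => ((a1 n.+1 + b2 n) +i* (a2 n.+1 - b1 n))%C
  | Negz n => ((a1 n.+1 - b2 n) +i* (a2 n.+1 + b1 n))%C
  end.
exists ([seq Posz n | n <- index_iota 0 N.+1] ++ [seq Negz n | n <- index_iota 0 N]), c.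
move=> x; rewrite big_cat !big_map.
rewrite big_nat_recl//= -addrA -big_split/=.
have -> : c 0 * Psi gamma 0 x = (a1 0%N * (P 0).[cos x] +i* (a2 0%N * (P 0).[cos x]))%C.
  rewrite PsiE /Psi_even /Psi_odd /=; move: (P 0) (normalized_jacobi _ 1 _) => p q.
  rewrite hornerZ; have r0 : Num.sqrt 2 != 0 :> R by rewrite sqrtr_eq0 -ltNge.
  apply/eqP; rewrite eq_complex /= sgz0 mulr0z mulr0 scale0r horner0.
  by apply/andP; split; apply/eqP; field.
under eq_bigr => n _.
  rewrite (_ : c n.+1 * Psi gamma n.+1 x + c (Negz n) * Psi gamma (Negz n) x =
    ((a1 n.+1 * (P n.+1).[cos x] + b1 n * (sin x * (Q n).[cos x])) +i*
     (a2 n.+1 * (P n.+1).[cos x] + b2 n * (sin x * (Q n).[cos x])))%C); last first.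
    rewrite Psi_posz Psi_negz; move: (P n.+1).[_] (Q n).[_] (sin x) => u v t.
    apply/eqP; rewrite eq_complex /=.
    by apply/andP; split; apply/eqP; field.
  over.
have sumC (f g : nat -> R) m : \sum_(0 <= n < m) (f n +i* g n)%C =
    ((\sum_(0 <= n < m) f n) +i* (\sum_(0 <= n < m) g n))%C :> R[i].
  elim: m => [|m IH]; first by rewrite !big_geq.
  by rewrite !big_nat_recr//= IH.
rewrite sumC.
have trigE p q (a b : nat -> R) : p = \sum_(i < N.+1) a i *: P i -> q = \sum_(i < N) b i *: Q i ->
    trig_poly p q x = a 0%N * (P 0).[cos x] +
    \sum_(0 <= n < N) (a n.+1 * (P n.+1).[cos x] + b n * (sin x * (Q n).[cos x])).
  move=> -> ->; rewrite /trig_poly !horner_sum big_ord_recl hornerZ -addrA.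
  congr (_ + _); rewrite big_split/= !big_mkord mulr_sumr; congr (_ + _).
    by apply: eq_bigr => i _; rewrite hornerZ.
  by apply: eq_bigr => i _; rewrite hornerZ mulrCA.
by rewrite (trigE _ _ _ _ a1E b1E) (trigE _ _ _ _ a2E b2E).
Qed.

Lemma Psi_complete : complete_in_L2 I w (Psi gamma).
Proof.
split.
  move=> g /finite_span_Psi_trig[p1 [q1 [p2 [q2 ->]]]].
  by apply: (L2_continuous hgamma); exact: continuous_trig_poly.
move=> f [mRe mIm iff] eps eps0.
(* The squared norm splits into real and imaginary parts, each allotted half of [eps^2]. *)
have e2 : 0 < eps ^+ 2 / 2 by rewrite divr_gt0 ?exprn_gt0.
have normE x : Normc.normc (f x) ^+ 2 = complex.Re (f x) ^+ 2 + complex.Im (f x) ^+ 2.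
  by case: (f x) => a b; exact: sqr_normc.
have mw : measurable_fun I w.
  by case/integrableP : (integrable_theta_weight hgamma) => /measurable_EFinP.
have iRe : mu.-integrable I (fun x => (complex.Re (f x) ^+ 2 * w x)%:E).
  apply: le_integrable iff => //.
    by apply/measurable_EFinP/measurable_funM => //; exact: measurable_funX.
  move=> x _.
  rewrite lee_fin (ger0_norm (mulr_ge0 (sqr_ge0 _) (theta_weight_ge0 _ _))).
  rewrite (le_trans _ (ler_norm _))// ler_wpM2r ?theta_weight_ge0//.
  by rewrite normE lerDl sqr_ge0.
have iIm : mu.-integrable I (fun x => (complex.Im (f x) ^+ 2 * w x)%:E).
  apply: le_integrable iff => //.
    by apply/measurable_EFinP/measurable_funM => //; exact: measurable_funX.
  move=> x _.
  rewrite lee_fin (ger0_norm (mulr_ge0 (sqr_ge0 _) (theta_weight_ge0 _ _))).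
  rewrite (le_trans _ (ler_norm _))// ler_wpM2r ?theta_weight_ge0//.
  by rewrite normE lerDr sqr_ge0.
have [p1 [q1 [i1 d1]]] := trig_dense hgamma mRe iRe e2.
have [p2 [q2 [i2 d2]]] := trig_dense hgamma mIm iIm e2.
exists (fun x => (trig_poly p1 q1 x +i* trig_poly p2 q2 x)%C).
  exact: trig_finite_span_Psi.
rewrite /L2_norm -[ltRHS]ger0_norm ?(ltW eps0)// -sqrtr_sqr ltr_sqrt ?exprn_gt0//.
rewrite (_ : \int[mu]_(x in I) _ =
  \int[mu]_(x in I) ((complex.Re (f x) - trig_poly p1 q1 x) ^+ 2 * w x +
                     (complex.Im (f x) - trig_poly p2 q2 x) ^+ 2 * w x)); last first.
  apply: eq_Rintegral => x _; rewrite -mulrDl; congr (_ * _).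
  by case: (f x) => a b; exact: sqr_normc.
by rewrite RintegralD// (splitr (eps ^+ 2)) ltrD.
Qed.

End Completeness.

Theorem theorem1 (R : realType) (gamma : R) (hgamma : - 2^-1 < gamma) :
  orthonormal_in_L2 `[- pi, pi] (theta_weight gamma) (Psi gamma) /\
  complete_in_L2 `[- pi, pi] (theta_weight gamma) (Psi gamma).
Proof.
by split; [exact: Psi_orthonormal|exact: Psi_complete].
Qed.
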